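(* Let $P^n$ be a simple polytope with $m$ facets, let $\lambda$ be a characteristic function on $P^n$, and let $J=(j_1,\dots,j_m)$ be a sequence of positive integers with $d(J)=j_1+\cdots+j_m$. Then the toric manifold $M(J)$ associated to $(P(J),\lambda(J))$ satisfies $$M(J)=\big(T^{d(J)-m+n}\times P(J)\big)/\!\sim_{\lambda(J)}\ \cong\ \big((S^{2j_1-1}\times S^{2j_2-1}\times\cdots\times S^{2j_m-1})/\ker\lambda\big)\times P^n/\!\sim_2 ,$$ where $\cong$ denotes homeomorphism and $S^1$ acts on each $S^{2j_i-1}\subset\mathbb{C}^{j_i}$ freely in the usual way, by scalar multiplication (the objects $P(J)$, $\lambda(J)$, $\sim_{\lambda(J)}$, $\ker\lambda$ and $\sim_2$ are defined in the context).
   Context: A polytope is simple if, in dimension $n$, exactly $n$ facets meet at each vertex. For a simple polytope $P$, $K_P$ is the simplicial complex dual to its boundary: vertices correspond to facets, and a set of vertices is a simplex iff the corresponding facets have non-empty intersection. A characteristic function on a simple polytope $Q$ of dimension $q$ with facets $F_1,\dots,F_r$ is a map $\mu:\{F_1,\dots,F_r\}\to\mathbb{Z}^q$ such that whenever $F_{i_1}\cap\cdots\cap F_{i_l}$ is a codimension-$l$ face, $\mu(F_{i_1}),\dots,\mu(F_{i_l})$ span a rank-$l$ direct summand of $\mathbb{Z}^q$. It is regarded as a $q\times r$ integer matrix, and as a homomorphism of tori $T^r\to T^q$ with kernel $\ker\mu\subset T^r$. For such a face $F$, $G_F\subset T^q$ is the rank-$l$ subtorus whose Lie algebra is spanned by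 $\mu(F_{i_1}),\dots,\mu(F_{i_l})$. On $T^q\times Q$ set $(g,p)\sim_\mu(g',p')$ iff $p=p'$ and $g^{-1}g'\in G_{F(p)}$, where $F(p)$ is the face with $p$ in its relative interior. The associated toric manifold is $T^q\times Q/\!\sim_\mu$. The complex $K(J)$: for a simplicial complex $K$ on $\{v_1,\dots,v_m\}$, $K(J)$ is the simplicial complex on vertices $\{v_{i1},\dots,v_{ij_i}: 1\le i\le m\}$ whose minimal non-faces are exactly the sets $\{v_{i_11},\dots,v_{i_1j_{i_1}},\dots,v_{i_k1},\dots,v_{i_kj_{i_k}}\}$ with $\{v_{i_1},\dots,v_{i_k}\}$ a minimal non-face of $K$. $P(J)$ denotes the simple polytope, of dimension $d(J)-m+n$ with $d(J)$ facets, such that $K_{P(J)}=K_P(J)$ (it exists by a result of Provan and Billera). The matrix $\lambda(J)$ is the $(d(J)-m+n)\times d(J)$ matrix with columns indexed by the vertices of $K_P(J)$, in the order $v_{12},\dots,v_{1j_1},v_{22},\dots,v_{2j_2},\dots,v_{m2},\dots,v_{mj_m},v_{11},v_{21},\dots,v_{m1}$, and the following rows: for each $i$ and each $2\le s\le j_i$ (in the same order), a row with entry $1$ in column $v_{is}$, entry $-1$ in column $v_{i1}$, and $0$ elsewhere; then $n$ further rows whose restriction to the columns $v_{11},\dots,v_{m1}$ is the $n\times m$ matrix $\lambda$ and whose other entries are $0$. It is a characteristic function on $P(J)$. Equivalently (by earlier work), $M(J)$ is given by the orbit space $Z(K_P;(\underline{D}^{2J},\underline{S}^{2J-1}))/\ker\lambda\cong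 Z(K_P(J);(D^2,S^1))/\ker\lambda(J)$, where for pairs $(A_i,B_i)$, $Z(K;(\underline{A},\underline{B}))=\bigcup_{\sigma\in K}\prod_i C_i(\sigma)$ with $C_i(\sigma)=A_i$ if $i\in\sigma$ and $B_i$ otherwise, and $(\underline{D}^{2J},\underline{S}^{2J-1})=\{(D^{2j_i},S^{2j_i-1})\}_{i=1}^m$; the $i$-th circle of $T^m$ acts on $D^{2j_i}\subset\mathbb{C}^{j_i}$ by scalar multiplication. The relation $\sim_2$: put $X_i=S^{2j_i-1}$. $T^m$ acts on $X_1\times\cdots\times X_m$ coordinatewise, and $\ker\lambda\subset T^m$ acts by restriction; for distinct indices $i_1,\dots,i_{m-k}$ it acts on $X_{i_1}\times\cdots\times X_{i_{m-k}}$ via the coordinate projection $T^m\to T^{m-k}$, and $\pi_{i_1,\dots,i_{m-k}}:(X_1\times\cdots\times X_m)/\ker\lambda\to(X_{i_1}\times\cdots\times X_{i_{m-k}})/\ker\lambda$ is the induced projection. On $\big((X_1\times\cdots\times X_m)/\ker\lambda\big)\times P^n$ set $(a,p)\sim_2(b,q)$ iff $p=q$ and $\pi_{i_1,\dots,i_{m-k}}(a)=\pi_{i_1,\dots,i_{m-k}}(b)$, where $F_{i_1},\dots,F_{i_{m-k}}$ are the facets of $P^n$ not containing $p$. *)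

(* Defs.v *)
From Corelib Require Import RelationClasses.
From HB Require Import structures.
From mathcomp Require Import all_boot all_order all_algebra generic_quotient.
From mathcomp Require Import all_classical all_reals all_analysis complex.
Set Implicit Arguments.
Unset Strict Implicit.
Unset Printing Implicit Defensive.
Import Order.TTheory GRing.Theory Num.Theory.
Import numFieldNormedType.Exports.
Local Open Scope classical_set_scope.
Local Open Scope ring_scope.
Local Open Scope complex_scope.
Local Open Scope quotient_scope.

Section Polytopes.
Context {R : realType} {N : nat}.
Notation V := 'rV[R]_N.
Implicit Types (A P : set V) (x a : V).

Definition aff_hull A : set V :=
  [set x | exists k (y : 'I_k -> V) (c : 'I_k -> R),
     [/\ forall i, A (y i), \sum_i c i = 1 & x = \sum_i c i *: y i]].

Definition aff_dim A (d : nat) : Prop :=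
  exists x (W : {vspace V}),
    \dim W = d /\ aff_hull A = [set x + v | v in [set` W]].

Definition rel_interior A : set V :=
  [set x | A x /\ \forall y \near x, aff_hull A y -> A y].

Definition polytope P : Prop :=
  bounded_set P /\
  exists k (H : 'M[R]_(N, k)) (b : 'rV[R]_k),
    P = [set x | forall i, (x *m H) 0 i <= b 0 i].

(* The empty set and the polytope itself count as faces. *)
Definition face P A : Prop :=
  exists (h : 'cV[R]_N) (b : R),
    (forall x, P x -> (x *m h) 0 0 <= b) /\
    A = P `&` [set x | (x *m h) 0 0 = b].

Definition codim_face P (l : nat) A : Prop :=
  face P A /\ exists d, aff_dim A d /\ aff_dim P (d + l).

Definition facet P A : Prop := codim_face P 1 A.

Definition simple_polytope (n m : nat) P (F : 'I_m -> set V) : Prop :=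
  [/\ polytope P, aff_dim P n,
      injective F /\ (forall A, facet P A <-> exists i, F i = A)
    & forall v, face P [set v] ->
        #|[pred i : 'I_m | `[< F i v >]]| = n].

Definition facet_inter (m : nat) P (F : 'I_m -> set V) (s : {set 'I_m}) :
    set V :=
  [set x | P x /\ forall i, i \in s -> F i x].

(* The face of [P] having [p] in its relative interior. *)
Definition carrier_face P (p : V) : set V :=
  xget set0 [set A | face P A /\ rel_interior A p].

(* The complex dual to the boundary of [P]; the vertex [i] stands for [F i]. *)
Definition dual_complex (m : nat) P (F : 'I_m -> set V) : set {set 'I_m} :=
  [set s | facet_inter P F s !=set0].

End Polytopes.

Definition simplicial_complex (T : finType) (K : set {set T}) : Prop :=
  K finset.set0 /\ forall s t : {set T}, t \subset s -> K s -> K t.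

Definition minimal_nonface (T : finType) (K : set {set T}) (s : {set T}) : Prop :=
  ~ K s /\ forall t : {set T}, t \proper s -> K t.

(* [extra J] is d(J) - m, see [extraE]. The vertices of K(J) are numbered
   v_12, .., v_1j_1, v_22, .., v_mj_m, v_11, v_21, .., v_m1, so that the first
   [extra J] of them are the v_is with 2 <= s (in lexicographic order, as
   provided by [tagnat]) and the last [m] are the v_i1. *)
Definition extra (m : nat) (J : 'I_m -> nat) : nat := (\sum_i (J i).-1)%N.

Lemma extraE (m : nat) (J : 'I_m -> nat) :
  (forall i, (0 < J i)%N) -> extra J = (\sum_i J i - m)%N.
Proof.
move=> J0; rewrite /extra; have -> : (\sum_i J i = \sum_i (J i).-1 + m)%N.
  rewrite -[X in (_ + X)%N]card_ord -sum1_card -big_split /=.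
  by apply: eq_bigr => i _; rewrite addn1 prednK.
by rewrite addnK.
Qed.

(* The index i of the vertex v_is. *)
Definition vertex_block (m : nat) (J : 'I_m -> nat) (v : 'I_(extra J + m)) :
    'I_m :=
  match fintype.split v with
  | inl k => tagnat.sig1 k
  | inr i => i
  end.
Arguments vertex_block {m} J v.

Definition is_KJ (m : nat) (J : 'I_m -> nat) (K : set {set 'I_m})
    (L : set {set 'I_(extra J + m)}) : Prop :=
  simplicial_complex L /\
  forall u, minimal_nonface L u <->
    exists2 s : {set 'I_m}, minimal_nonface K s &
      u = finset (fun v => vertex_block J v \in s).

(* [Q], with its facets [G], is P(J): facets are matched with the vertices of
   K_P(J) through their numbering. *)
Definition is_PJ (R : realType) (N N' n m : nat) (J : 'I_m -> nat)
    (P : set 'rV[R]_N) (F : 'I_m -> set 'rV[R]_N)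
    (Q : set 'rV[R]_N') (G : 'I_(extra J + m) -> set 'rV[R]_N') : Prop :=
  simple_polytope (extra J + n) Q G /\
  is_KJ (dual_complex P F) (dual_complex Q G).

Section Lattices.
Context {q r : nat}.
Implicit Types (H C : set 'cV[int]_q) (mu : 'M[int]_(q, r)).

Definition additive_subgroup H : Prop :=
  H 0 /\ forall x y, H x -> H y -> H (x - y).

Definition direct_summand H : Prop :=
  additive_subgroup H /\
  exists C, [/\ additive_subgroup C, H `&` C = [set 0] &
    forall x, exists y z, [/\ H y, C z & x = y + z]].

Definition col_span mu (s : {set 'I_r}) : set 'cV[int]_q :=
  [set x | exists c : 'I_r -> int, x = \sum_(i in s) c i *: col i mu].

Definition col_rank mu (s : {set 'I_r}) : nat :=
  \rank (map_mx (intr : int -> rat) (colsub (@enum_val _ (mem s)) mu)).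

End Lattices.

(* The value of [mu] on the facet [F i] is the column [i] of the matrix. *)
Definition characteristic_function (R : realType) (N q r : nat)
    (P : set 'rV[R]_N) (F : 'I_r -> set 'rV[R]_N) (mu : 'M[int]_(q, r)) : Prop :=
  forall s : {set 'I_r}, codim_face P #|s| (facet_inter P F s) ->
    col_rank mu s = #|s| /\ direct_summand (col_span mu s).

(* In block form, lambda(J) = [ 1  -B ; 0  lambda ], where the row of B of index
   (i, s) has its only nonzero entry, 1, in the column of v_i1. *)
Definition lambdaJ (m n : nat) (J : 'I_m -> nat) (lambda : 'M[int]_(n, m)) :
    'M[int]_(extra J + n, extra J + m) :=
  block_mx 1%:M (- \matrix_(k, i) (tagnat.sig1 k == i)%:R) 0 lambda.

Definition homeomorphic (X Y : topologicalType) : Prop :=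
  exists (f : X -> Y) (g : Y -> X),
    [/\ continuous f, continuous g, cancel f g & cancel g f].

Section Quotients.
Context {T : topologicalType} {r : T -> T -> Prop} (r_equiv : Equivalence r).

Lemma asbool_equiv : equiv_class_of (fun x y => `[< r x y >]).
Proof.
split=> [x|x y|y x z /asboolP xy /asboolP yz].
- by apply/asboolP; reflexivity.
- by apply: asbool_equiv_eq; split=> h; symmetry.
- by apply/asboolP; transitivity y.
Qed.

Definition quotient_space : topologicalType :=
  quotient_topology {eq_quot (EquivRelPack asbool_equiv)}.

Definition quotient_map : T -> quotient_space := \pi_{eq_quot (EquivRelPack asbool_equiv)}.

Lemma quotient_mapP x y : quotient_map x = quotient_map y <-> r x y.
Proof. by split=> [/eqmodP/asboolP//|h]; apply/eqmodP/asboolP. Qed.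

End Quotients.

(* The topology of numeric fields is attached to their regular algebra. *)
Notation Cplx R := ((R[i])^o).

Section Toric.
Context {R : realType}.

Definition circle : set (Cplx R) := [set z | `|z| = 1].

Definition torus (k : nat) : topologicalType :=
  prod_topology (fun _ : 'I_k => circle).

Definition torus_of (k : nat) (z : 'I_k -> R[i]) (z1 : forall i, `|z i| = 1) :
  torus k := fun i => SigSub (mem_set (z1 i) : z i \in circle).

Lemma torus_ofE k (z : 'I_k -> R[i]) z1 i : \val (torus_of (z := z) z1 i) = z i.
Proof. by []. Qed.

(* S^(2j-1) in C^j *)
Definition sphere (j : nat) : set 'rV[Cplx R]_j :=
  [set z | \sum_i `|z 0 i| ^+ 2 = 1].
Arguments sphere : clear implicits.

Definition torus_kernel (q r : nat) (mu : 'M[int]_(q, r)) : set (torus r) :=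
  [set t | forall a, \prod_i (\val (t i) : R[i]) ^ mu a i = 1].

Definition torus_exp (q : nat) (theta : 'I_q -> R) : 'I_q -> R[i] :=
  fun a => cos (theta a) +i* sin (theta a).

(* The subtorus G_A of T^q, as a subset of C^q: the image under the exponential
   map of the span of the values of [mu] on the facets containing [A]. *)
Definition face_torus (N q r : nat) (F : 'I_r -> set 'rV[R]_N)
    (mu : 'M[int]_(q, r)) (A : set 'rV[R]_N) : set ('I_q -> R[i]) :=
  [set g | exists c : 'I_r -> R, (forall i, ~ A `<=` F i -> c i = 0) /\
     g = torus_exp (fun a => \sum_i c i * (mu a i)%:~R)].

Lemma torus_expD (q : nat) (x y : 'I_q -> R) a :
  torus_exp (fun a => x a + y a) a = torus_exp x a * torus_exp y a.
Proof.
rewrite /torus_exp cosD sinD; simpc.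
by rewrite [X in _ +i* X]addrC [X in _ +i* (X + _)]mulrC.
Qed.

Lemma torus_expN (q : nat) (x : 'I_q -> R) a :
  torus_exp (fun a => - x a) a = (torus_exp x a)^-1.
Proof.
apply/esym/mulr1_eq; rewrite -torus_expD.
by rewrite /torus_exp subrr cos0 sin0.
Qed.

Section ToricManifold.
Context {N q r : nat} (Q : set 'rV[R]_N) (F : 'I_r -> set 'rV[R]_N).
Context (mu : 'M[int]_(q, r)).

Definition toric_rel (x y : torus q * Q) : Prop :=
  \val x.2 = \val y.2 /\
  face_torus F mu (carrier_face Q (\val x.2))
    (fun a => (\val (x.1 a) : R[i])^-1 * \val (y.1 a)).

Lemma toric_rel_equiv : Equivalence toric_rel.
Proof.
have val0 (t : torus q) a : (\val (t a) : R[i]) != 0.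
  by rewrite -normr_eq0 (set_valP (t a)) oner_eq0.
split.
- move=> x; split=> //; exists (fun=> 0); split=> //.
  apply/funext => a; rewrite mulVf ?val0//.
  by rewrite /torus_exp big1 ?cos0 ?sin0// => i _; rewrite mul0r.
- move=> x y [xy [c [c0 cE]]]; split=> //; rewrite -xy.
  exists (fun i => - c i); split=> [i /c0 ->|]; first by rewrite oppr0.
  apply/funext => a; have := congr1 (fun g => g a) cE.
  rewrite (_ : (fun a => \sum_i (- c i) * (mu a i)%:~R) =
    (fun a => - \sum_i c i * (mu a i)%:~R)); last first.
    by apply/funext => b; rewrite -sumrN; apply: eq_bigr => i _; rewrite /= mulNr.
  by rewrite torus_expN => <-; rewrite invfM invrK mulrC.
- move=> x y z [xy [c [c0 cE]]] [yz [d [d0 dE]]]; split; first by rewrite xy.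
  rewrite -xy in d0; exists (fun i => c i + d i); split=> [i Fi|].
    by rewrite c0 ?d0 ?addr0.
  apply/funext => a.
  rewrite (_ : (fun a => \sum_i (c i + d i) * (mu a i)%:~R) =
    (fun a => \sum_i c i * (mu a i)%:~R +
    \sum_i d i * (mu a i)%:~R)); last first.
    by apply/funext => b; rewrite -big_split; apply: eq_bigr => i _; rewrite /= mulrDl.
  have /= cEa := congr1 (fun g => g a) cE; have /= dEa := congr1 (fun g => g a) dE.
  by rewrite torus_expD -cEa -dEa mulrA mulfK ?val0.
Qed.

Definition toric_manifold : topologicalType := quotient_space toric_rel_equiv.

End ToricManifold.

Section SphereQuotient.
Context {n m : nat} (J : 'I_m -> nat) (lambda : 'M[int]_(n, m)).

(* The product of the S^(2 j_(f k) - 1), k in I; [f] is either the identity or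
   the inclusion of a set of indices. *)
Definition spheres (I : Type) (f : I -> 'I_m) : topologicalType :=
  prod_topology (fun k => sphere (J (f k))).

Definition orbit_rel (I : Type) (f : I -> 'I_m) (x y : spheres f) : Prop :=
  exists2 t, torus_kernel lambda t &
    forall k, \val (y k) = (\val (t (f k)) : R[i]) *: \val (x k).

Lemma orbit_rel_equiv (I : Type) (f : I -> 'I_m) : Equivalence (@orbit_rel I f).
Proof.
have val0 (t : torus m) a : (\val (t a) : R[i]) != 0.
  by rewrite -normr_eq0 (set_valP (t a)) oner_eq0.
split.
- move=> x; exists (torus_of (fun=> normr1 _)) => [a|k].
    by rewrite big1// => i _; rewrite torus_ofE exp1rz.
  by rewrite torus_ofE scale1r.
- move=> x y [t tk xy].
  have tV i : `|(\val (t i))^-1 : R[i]| = 1.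
    by rewrite normfV (set_valP (t i)) invr1.
  exists (torus_of tV) => [a|k].
    under eq_bigr do rewrite torus_ofE exprz_inv -invr_expz.
    by rewrite prodfV tk invr1.
  by rewrite torus_ofE xy scalerA mulVf ?val0// scale1r.
- move=> x y z [t tk xy] [u uk yz].
  have tu i : `|\val (t i) * \val (u i) : R[i]| = 1.
    by rewrite normrM (set_valP (t i)) (set_valP (u i)) mulr1.
  exists (torus_of tu) => [a|k].
    under eq_bigr do rewrite torus_ofE expfzMl.
    by rewrite big_split /= tk uk mulr1.
  by rewrite torus_ofE yz xy scalerA mulrC.
Qed.

Definition orbit_space (I : Type) (f : I -> 'I_m) : topologicalType :=
  quotient_space (@orbit_rel_equiv I f).

Definition orbit_map (I : Type) (f : I -> 'I_m) : spheres f -> orbit_space f :=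
  quotient_map (@orbit_rel_equiv I f).

(* The projection to the coordinates in [I], and the map it induces on the
   orbit spaces. *)
Definition sphere_proj (I : {set 'I_m}) (x : spheres id) :
    spheres (fun k : {i | i \in I} => \val k) :=
  fun k => x (\val k).
Arguments sphere_proj I x : clear implicits.

Definition orbit_proj (I : {set 'I_m}) (a : orbit_space id) :
    orbit_space (fun k : {i | i \in I} => \val k) :=
  orbit_map (sphere_proj I (repr a)).
Arguments orbit_proj I a : clear implicits.

Lemma orbit_projE (I : {set 'I_m}) (x : spheres id) :
  orbit_proj I (orbit_map x) = orbit_map (sphere_proj I x).
Proof.
rewrite /orbit_proj; apply/(quotient_mapP (orbit_rel_equiv _)).
have [t tk xt] : orbit_rel (repr (orbit_map x)) x.
  by apply/(quotient_mapP (orbit_rel_equiv _)); exact: reprK.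
by exists t => // k; exact: xt.
Qed.

Section SpherePolytope.
Context {N : nat} (P : set 'rV[R]_N) (F : 'I_m -> set 'rV[R]_N).

Definition avoiding_facets (p : 'rV[R]_N) : {set 'I_m} :=
  finset (fun i => ~~ `[< F i p >]).

Definition sphere_rel (x y : orbit_space id * P) : Prop :=
  \val x.2 = \val y.2 /\
  orbit_proj (avoiding_facets (\val x.2)) x.1 =
  orbit_proj (avoiding_facets (\val x.2)) y.1.

Lemma sphere_rel_equiv : Equivalence sphere_rel.
Proof.
split=> [x|x y [xy aE]|x y z [xy aE] [yz bE]]; first by split.
- by split; rewrite -xy.
- by split; [rewrite xy | rewrite aE xy].
Qed.

Definition sphere_quotient : topologicalType := quotient_space sphere_rel_equiv.

End SpherePolytope.
End SphereQuotient.
End Toric.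

(* Main.v *)
(* Both spaces are quotients of one compact space. A simple polytope is homeomorphic,
   facet by facet, to the order complex of its dual complex: send barycentric
   coordinates supported on a chain of simplices s to the corresponding combination
   of points b s, where b s lies exactly on the facets in s. Hence a simple
   polytope depends, up to facet-preserving homeomorphism, only on its dual complex,
   and P(J) may be replaced by the set of (x, w) with x in P, w >= 0 and
   w_i1 + .. + w_ij_i equal to the i-th slack of x. Writing w_is as the i-th slack
   times |z_is|^2, with z_i in S^(2 j_i - 1), trades a point (x, w) with angles
   theta_is for a point x of P with unit vectors z_i having the arguments theta_is.
   Accordingly the compact space of all (theta, flag coordinates of (x, w), |z|) maps
   onto T x P(J) and onto the product of the spheres with P, and composing with the
   projections to the two quotients gives the same fibres, because ker lambda(J) is
   the block-diagonal copy of ker lambda. *)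

Require Import Defs.
From Corelib Require Import RelationClasses.
From mathcomp Require Import all_boot all_order all_algebra.
From mathcomp Require Import all_classical all_reals all_analysis complex.
From mathcomp Require Import lra ring.
Set Implicit Arguments.
Unset Strict Implicit.
Unset Printing Implicit Defensive.
Import Order.TTheory GRing.Theory Num.Theory.
Import numFieldNormedType.Exports.
Local Open Scope classical_set_scope.
Local Open Scope ring_scope.

(** * Barycentric coordinates on cells *)

(** Only the dual complex of [Q] is known and no map from [P] to [Q] is given, so the same flag
    coordinates are evaluated twice: with centers in [Q], and with centers in the polytope of pairs
    (x, w). To serve both, barycentric coordinates are developed for any affine space with finitely
    many affine functions required to be nonnegative.

    A point of T x P(J) does not determine a point of the spheres times P, nor conversely: where a
    slack of P vanishes, w does not determine the moduli |z_is|, and where z_is = 0 the angle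
    theta_is is lost. This is why angles and moduli are carried separately.

    Compactness of the parameter space spares the construction of inverse maps: a continuous
    surjection onto a Hausdorff space is then a quotient mapping, and quotient mappings with the
    same fibres have homeomorphic targets. Only the two products are shown to be Hausdorff, not the
    final quotients. *)

Section Cells.
Context {R : realFieldType} {V : lmodType R} {I : finType}.
Implicit Types (aff : set V) (y : I -> V -> R) (x z : V).

Definition affine_closed aff : Prop :=
  forall (T : finType) (t : T -> R) (p : T -> V),
    \sum_j t j = 1 -> (forall j, aff (p j)) -> aff (\sum_j t j *: p j).

Definition affine_map (f : V -> R) : Prop :=
  forall (T : finType) (t : T -> R) (p : T -> V),
    \sum_j t j = 1 -> f (\sum_j t j *: p j) = \sum_j t j * f (p j).

Definition inside aff y x : Prop := aff x /\ forall i, 0 <= y i x.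

Definition zeros y x : {set I} := finset (fun i => y i x == 0).

(* The last condition says that [inside aff y] contains no ray. *)
Record cell aff y : Prop := Cell {
  cell_aff : affine_closed aff;
  cell_map : forall i, affine_map (y i);
  cell_ray : forall x z, inside aff y x -> aff z -> x != z ->
    exists i, y i z < y i x }.

(** The last two fields make [K] exactly the set of zero sets of points of the cell. Outside [K] the
    value [b s] is a placeholder, but still a point of the cell, so combinations of centers need no
    side condition. *)
Record centers aff y (K : set {set I}) (b : {set I} -> V) : Prop := Centers {
  center_inside : forall s : {set I}, inside aff y (b s);
  center_zeros : forall s : {set I}, K s -> zeros y (b s) = s;
  zeros_complex : forall x, inside aff y x -> K (zeros y x) }.

(** * Moving along lines inside a cell *)

Section Lines.
Context {aff : set V} {y : I -> V -> R}.

Lemma lineE x z s :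
  x + s *: (z - x) = \sum_(c : bool) (if c then s else 1 - s) *: (if c then z else x).
Proof. by rewrite big_bool /= scalerBl scalerBr scale1r addrCA. Qed.

Lemma aff_line x z s : affine_closed aff -> aff x -> aff z -> aff (x + s *: (z - x)).
Proof.
move=> hA ax az; rewrite lineE; apply: hA; first by rewrite big_bool /=; ring.
by case.
Qed.

Lemma map_line (f : V -> R) x z s : affine_map f ->
  f (x + s *: (z - x)) = f x + s * (f z - f x).
Proof.
by move=> hf; rewrite lineE hf big_bool /=; ring.
Qed.

(** Ratio test: along the line from [x] through [z], a decreasing [y i] vanishes at the parameter
    [f i], and at the least of these parameters no function has become negative yet. *)
Lemma cell_exit x z : cell aff y -> inside aff y x -> aff z ->
  (exists i, y i z < y i x) ->
  exists s i, [/\ 0 <= s, inside aff y (x + s *: (z - x)), y i z < y i x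
    & y i (x + s *: (z - x)) = 0].
Proof.
move=> [hA hm _] [ax x0] az [i0 i0P].
pose f i := y i x / (y i x - y i z).
case: (@arg_minP _ _ I i0 (fun i => y i z < y i x) f i0P) => i iP imin.
have di : 0 < y i x - y i z by rewrite subr_gt0.
have fi : 0 <= f i by rewrite divr_ge0 ?x0// ltW.
exists (f i), i; split=> //; last first.
  by rewrite map_line// /f -[y i z - _]opprB mulrN divfK ?subrr// gt_eqF.
split=> [|j]; first exact: aff_line.
rewrite map_line//; have [jP|jP] := ltP (y j z) (y j x); last first.
  by rewrite addr_ge0// mulr_ge0// subr_ge0.
have dj : 0 < y j x - y j z by rewrite subr_gt0.
have := imin j jP; rewrite /f ler_pdivlMr// => h.
by rewrite -[y j z - _]opprB mulrN subr_ge0.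
Qed.

(** As long as some other point of the affine space vanishes wherever [x] does, one moves towards it
    until a further function vanishes; [cell_ray] provides a decreasing function. *)
Lemma cell_vertex x : cell aff y -> inside aff y x ->
  exists v, [/\ inside aff y v, zeros y x \subset zeros y v
    & forall z, aff z -> zeros y v \subset zeros y z -> z = v].
Proof.
move=> hC; have [n] := ubnP #|~: zeros y x|; elim: n x => // n IH x xn hx.
have [h|] := pselect (forall z, aff z -> zeros y x \subset zeros y z -> z = x).
  by exists x.
move=> /existsNP[z /not_implyP[az /not_implyP[/fintype.subsetP xz /eqP zx]]].
rewrite eq_sym in zx.
have [s [i [_ hq iz yq]]] := cell_exit hC hx az (cell_ray hC hx az zx).
set q := x + _ in hq yq; have xq : zeros y x \proper zeros y q.
  apply/properP; split; last first.
    exists i; rewrite inE ?yq//; apply: contraTN iz => /eqP yx.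
    by have := xz i; rewrite !inE yx eqxx => /(_ isT)/eqP ->; rewrite ltxx.
  apply/fintype.subsetP => j jx; have := xz j jx; move: jx.
  rewrite !inE /q map_line; last exact: (cell_map hC).
  by move=> /eqP -> /eqP ->; rewrite subrr mulr0 addr0.
have [|v [hv qv vz]] := IH q _ hq.
  have := xn; rewrite ltnS; apply: leq_trans; apply: proper_card.
  by rewrite properC.
by exists v; split=> //; apply: fintype.subset_trans (proper_sub xq) qv.
Qed.

End Lines.

(** The geometric realization of the order complex of [K]. The empty simplex takes part: its center
    is an interior point, so the flags fill the whole polytope and not only its boundary. *)
Definition flag_simplex (K : set {set I}) : set ({set I} -> R) :=
  [set t | [/\ forall s, 0 <= t s, \sum_s t s = 1, forall s, t s != 0 -> K s
    & forall s s', t s != 0 -> t s' != 0 -> (s \subset s') || (s' \subset s)]].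

Definition barycenter (b : {set I} -> V) (t : {set I} -> R) : V := \sum_s t s *: b s.

Section Barycentric.
Context {aff : set V} {y : I -> V -> R} {K : set {set I}} {b : {set I} -> V}.
Hypotheses (hC : cell aff y) (hb : centers aff y K b).
Local Notation D := (flag_simplex K).
Local Notation beta := (barycenter b).

Lemma map_barycenter t i : D t -> y i (beta t) = \sum_s t s * y i (b s).
Proof. by case=> _ t1 _ _; apply: (cell_map hC). Qed.

Lemma barycenter_inside t : D t -> inside aff y (beta t).
Proof.
move=> Dt; split=> [|i]; last first.
  rewrite map_barycenter//; apply: sumr_ge0 => s _.
  by rewrite mulr_ge0 ?(center_inside hb s).2//; case: Dt.
by case: Dt => _ t1 _ _; apply: (cell_aff hC) => // s; case: (center_inside hb s).
Qed.

(** All slacks are nonnegative at the centers, so one vanishes at the barycenter only if it vanishes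
    at every center of the support. The zero set is thus the least member of the chain. *)
Lemma barycenter_zeros t i : D t ->
  i \in zeros y (beta t) <-> forall s, t s != 0 -> i \in s.
Proof.
move=> Dt; have [t0 t1 tK _] := Dt; rewrite inE map_barycenter//.
have h0 s : 0 <= t s * y i (b s) by rewrite mulr_ge0 ?(center_inside hb s).2.
rewrite psumr_eq0//; split=> [/allP h s ts|h].
  have := h s (mem_index_enum _); rewrite /= mulf_eq0 (negPf ts) /= => yi.
  by rewrite -(center_zeros hb (tK s ts)) inE.
apply/allP => s _ /=; rewrite mulf_eq0; have [//|ts /=] := eqVneq (t s) 0.
by have := h s ts; rewrite -{1}(center_zeros hb (tK s ts)) inE.
Qed.

Definition vertex_weight (s : {set I}) : {set I} -> R := fun s' => (s' == s)%:R.

Lemma sum_vertex_weight (f : {set I} -> V) s :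
  \sum_s' vertex_weight s s' *: f s' = f s.
Proof.
rewrite (bigD1 s)//= /vertex_weight eqxx scale1r big1 ?addr0// => j /negPf ->.
by rewrite scale0r.
Qed.

Lemma sum_vertex_weight1 s : \sum_s' vertex_weight s s' = 1.
Proof.
by rewrite (bigD1 s)//= /vertex_weight eqxx big1 ?addr0// => j /negPf ->.
Qed.

Lemma zeros_barycenter_sub t s : D t -> t s != 0 -> zeros y (beta t) \subset s.
Proof. by move=> Dt ts; apply/fintype.subsetP => i /(barycenter_zeros i Dt); apply. Qed.

(* A point which is not a center lies on a segment from the center of its face to a
   point where further functions vanish. *)
Lemma barycenter_surj x : inside aff y x -> exists2 t, D t & beta t = x.
Proof.
have [n] := ubnP #|~: zeros y x|; elim: n x => // n IH x xn hx.
set s0 := zeros y x in xn *.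
have Ks0 : K s0 by apply: (zeros_complex hb).
have [<-|xb] := eqVneq (b s0) x.
  exists (vertex_weight s0); last exact: sum_vertex_weight.
  split=> [s||s|s s']; rewrite /vertex_weight.
  - by rewrite ler0n.
  - exact: sum_vertex_weight1.
  - by have [->|_] := eqVneq s s0; rewrite ?eqxx.
  - by have [->|_] := eqVneq s s0; have [->|_] := eqVneq s' s0; rewrite ?eqxx ?subxx.
have ab : aff (b s0) by case: (center_inside hb s0).
(* The factor 2 continues the segment beyond [x], away from the center: [z - x] equals
   [x - b s0]. *)
pose z := b s0 + 2 *: (x - b s0).
have az : aff z by apply: aff_line => //; [exact: (cell_aff hC)|case: hx].
have zx : z - x = x - b s0.
  by rewrite /z scaler_nat mulr2n [b s0 + _]addrA [b s0 + _]addrC subrK addrAC subrr add0r.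
have xz : x != z by rewrite eq_sym -subr_eq0 zx subr_eq0 eq_sym.
have [s [i [s_ge0 hq iz yq]]] := cell_exit hC hx az (cell_ray hC hx az xz).
rewrite zx in hq yq; set q := x + s *: (x - b s0) in hq yq.
have qz : s0 \proper zeros y q.
  have hl j : y j q = y j x + s * (y j x - y j (b s0)).
    rewrite /q -zx map_line; last exact: (cell_map hC).
    rewrite /z map_line; [ring|exact: (cell_map hC)].
  apply/properP; split.
    apply/fintype.subsetP => j js; have : j \in zeros y (b s0) by rewrite (center_zeros hb Ks0).
    by move: js; rewrite !inE hl => /eqP -> /eqP ->; rewrite subr0 mulr0 addr0.
  exists i; first by rewrite inE yq.
  rewrite inE; apply/negP => /eqP yi; have yz : y i z = - y i (b s0).
    rewrite /z map_line; last exact: (cell_map hC).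
    by rewrite yi; ring.
  have : i \in zeros y (b s0) by rewrite (center_zeros hb Ks0) inE yi.
  by rewrite inE => /eqP yb; move: iz; rewrite yz yi yb oppr0 ltxx.
have [|t Dt tq] := IH q _ hq.
  have := xn; rewrite ltnS; apply: leq_trans; apply: proper_card.
  by rewrite properC.
(* Every simplex in the support of [t] contains the zero set of [q], which is strictly larger than
   [s0]; so [s0] can be added at the bottom of the chain. *)
have t0 : t s0 = 0.
  apply/eqP; apply: contraTT qz => ts.
  by have := zeros_barycenter_sub Dt ts; rewrite tq properE => ->; rewrite andbF.
have [tge t1 tK tc] := Dt.
have s1 : 0 < 1 + s by rewrite ltr_pwDl.
have zs s' : t s' != 0 -> s0 \subset s'.
  move=> ts; apply: fintype.subset_trans (proper_sub qz) _.
  by rewrite -tq zeros_barycenter_sub.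
(* Solving [q = x + s (x - b s0)] for [x] gives [x = (s b s0 + q) / (1 + s)]. *)
exists (fun s' => (1 + s)^-1 * (s * vertex_weight s0 s' + t s')); last first.
  rewrite /barycenter (eq_bigr (fun s' =>
    (1 + s)^-1 *: (s *: (vertex_weight s0 s' *: b s') + t s' *: b s'))).
    rewrite -scaler_sumr big_split /= -scaler_sumr sum_vertex_weight -/(barycenter b t) tq /q.
    apply: (scalerI (lt0r_neq0 s1)); rewrite scalerA divff ?gt_eqF// scale1r.
    by rewrite scalerBr scalerDl scale1r addrCA [s *: b s0 + _]addrC subrK.
  by move=> s' _; rewrite -scalerA scalerDl scalerA.
have nz s' : (1 + s)^-1 * (s * vertex_weight s0 s' + t s') != 0 -> s' = s0 \/ t s' != 0.
  have [->|ss] := eqVneq s' s0; first by left.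
  by rewrite /vertex_weight (negPf ss) mulr0 add0r mulf_eq0 negb_or => /andP[_ ts]; right.
split=> [s'||s'|s' s''].
- by rewrite mulr_ge0 ?invr_ge0 ?(ltW s1)// addr_ge0// mulr_ge0// ler0n.
- by rewrite -mulr_sumr big_split /= -mulr_sumr sum_vertex_weight1 t1 mulr1 addrC mulVf// gt_eqF.
- by move=> /nz[->//|/tK].
- move=> /nz[->|ts] /nz[->|ts']; rewrite ?subxx ?(zs _ ts) ?(zs _ ts') ?orbT//.
  exact: tc.
Qed.

(** The zero set of the barycenter is the least simplex of the support. Removing it and rescaling
    the other weights leaves a chain with a larger least member, hence a barycenter on a strictly
    smaller face. *)
Lemma peel_vertex t (s0 := zeros y (beta t)) : D t -> t s0 != 1 ->
  exists2 t', D t' & [/\ zeros y (beta t) \proper zeros y (beta t'),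
    forall s, t s = t s0 * vertex_weight s0 s + (1 - t s0) * t' s & t s0 < 1].
Proof.
move=> Dt ts1; have [t0 t1 tK tc] := Dt.
have lt1 : t s0 < 1.
  rewrite lt_neqAle ts1 -t1 (bigD1 s0)//= lerDl sumr_ge0// => s _; exact: t0.
have u0 : 0 < 1 - t s0 by rewrite subr_gt0.
pose t' s := (1 - t s0)^-1 * (t s - t s0 * vertex_weight s0 s).
have t'E s : t' s = if s == s0 then 0 else (1 - t s0)^-1 * t s.
  rewrite /t' /vertex_weight; case: eqVneq => [->|_]; first by rewrite mulr1 subrr mulr0.
  by rewrite mulr0 subr0.
have nz s : t' s != 0 -> t s != 0 /\ s != s0.
  rewrite t'E; case: (eqVneq s s0) => [_|ss]; first by rewrite eqxx.
  by rewrite mulf_eq0 negb_or => /andP[].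
have Dt' : D t'.
  split=> [s||s /nz[/tK]//|s s' /nz[h _] /nz[h' _]].
  - by rewrite t'E; case: ifP => // _; rewrite mulr_ge0// invr_ge0 ltW.
  - rewrite -mulr_sumr sumrB -mulr_sumr sum_vertex_weight1 t1 mulr1 mulVf// gt_eqF//.
  - exact: tc.
exists t' => //; split=> //; last first.
  by move=> s; rewrite /t' mulrA divff ?gt_eqF// mul1r addrC subrK.
rewrite finset.properEneq; apply/andP; split; last first.
  apply/fintype.subsetP => i /(barycenter_zeros i Dt) h; apply/(barycenter_zeros i Dt') => s.
  by move=> /nz[/h].
have [s ts] : exists s, t' s != 0.
  apply/existsP; apply: contraTT (oner_neq0 R) => /existsPn h.
  by have [_ <- _ _] := Dt'; rewrite negbK big1// => s _; apply/eqP; have := h s; rewrite negbK.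
(* In a chain, a member of least cardinality is contained in all the others. *)
case: (@arg_minnP _ s (fun s => t' s != 0) (fun s => #|s|) ts) => s1 ts1' s1min.
have [ts1'' s1s0] := nz _ ts1'.
have s0s1 : s0 \proper s1 by rewrite finset.properEneq eq_sym s1s0 zeros_barycenter_sub.
case/properP: s0s1 => _ [i is1 is0]; apply: contraNneq is0 => e; rewrite /s0 e.
apply/(barycenter_zeros i Dt') => s' ts'.
have [_ _ _ /(_ _ _ ts' ts1')] := Dt'; case/orP => [h|/fintype.subsetP]; last exact.
have /eqP -> // : s' == s1 by rewrite eqEcard h s1min.
Qed.

(** The point determines the common least simplex [s0]. Away from the center, both peeled
    barycenters lie on the ray from [b s0] through the point, at the place where it leaves the cell;
    so they agree, the weights of [s0] agree, and induction applies. *)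
Lemma barycenter_inj t t' : D t -> D t' -> beta t = beta t' -> t = t'.
Proof.
have [n] := ubnP #|~: zeros y (beta t)|; elim: n t t' => // n IH t t' tn Dt Dt' tt'.
set s0 := zeros y (beta t).
have vert u : D u -> u s0 = 1 -> u = vertex_weight s0.
  move=> [u0 u1 _ _] us; apply/funext => s; rewrite /vertex_weight; case: eqVneq => [->//|ss].
  have := u1; rewrite (bigD1 s0)//= us -[RHS]addr0 => /addrI /eqP.
  rewrite psumr_eq0 => [/allP/(_ s (mem_index_enum _))|? _]; last exact: u0.
  by rewrite ss /= => /eqP.
have vertb : K s0 -> zeros y (b s0) = s0 by exact: center_zeros hb _.
have Ks0 : K s0 by apply: (zeros_complex hb); exact: barycenter_inside.
have split_bary u u' : (forall s, u s = u s0 * vertex_weight s0 s + (1 - u s0) * u' s) ->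
    beta u = b s0 + (1 - u s0) *: (beta u' - b s0).
  move=> h; rewrite /barycenter (eq_bigr (fun s =>
    u s0 *: (vertex_weight s0 s *: b s) + (1 - u s0) *: (u' s *: b s))).
    rewrite big_split /= -!scaler_sumr sum_vertex_weight scalerBr.
    rewrite [_ *: b s0 in RHS]scalerBl scale1r.
    by rewrite opprB [RHS]addrC -addrA subrK addrC.
  by move=> s _; rewrite {1}h scalerDl !scalerA.
(* If a flag other than [s0] alone had the center [b s0] as barycenter, peeling would put [b s0] on
   a strictly smaller face. *)
have vertE u u' : D u -> D u' -> zeros y (beta u) = s0 -> beta u = beta u' -> u' s0 = 1 -> u s0 = 1.
  move=> Du Du' uz uu' u's.
  apply/eqP; apply/negPn/negP => us; rewrite -uz in us.
  have [v Dv [pv hv lt1]] := peel_vertex Du us; rewrite uz in pv hv lt1.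
  have := split_bary _ _ hv; rewrite uu' (vert _ Du' u's).
  rewrite {1}/barycenter sum_vertex_weight -[LHS]addr0 => /addrI/esym/eqP.
  rewrite scaler_eq0 subr_eq0 (gt_eqF lt1) subr_eq0 /= => /eqP vb.
  by move: pv; rewrite vb vertb// fintype.properxx.
have [ts|ts] := eqVneq (t s0) 1.
  by rewrite (vert t)// (vert t')//; apply: vertE Dt' Dt _ _ ts; rewrite -?tt'.
have ts' : t' s0 != 1 by apply: contra_neq ts => ts'; apply: vertE Dt Dt' _ _ ts'.
have [v Dv [pv hv lt1]] := peel_vertex Dt ts.
have zt' : zeros y (beta t') = s0 by rewrite -tt'.
rewrite -zt' in ts'.
have [v' Dv' [pv' hv' lt1']] := peel_vertex Dt' ts'.
rewrite zt' in ts' pv' hv' lt1'; rewrite -/s0 in pv hv lt1.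
have E : (1 - t s0) *: (beta v - b s0) = (1 - t' s0) *: (beta v' - b s0).
  by apply: (@addrI _ (b s0)); rewrite -!split_bary.
(* the two exit points lie on one ray from [b s0], and strictly between
   [b s0] and a point of [inside] no function outside of [s0] vanishes *)
have noteq u u' w w' : D w -> D w' -> s0 \proper zeros y (beta w') -> 0 < u -> u < u' ->
    u *: (beta w - b s0) = u' *: (beta w' - b s0) -> False.
  move=> Dw Dw' pw' u0 uu' e; have u'0 := lt_trans u0 uu'.
  have e' : beta w' = b s0 + (u / u') *: (beta w - b s0).
    rewrite mulrC -scalerA e scalerA mulVf ?gt_eqF// scale1r addrC subrK//.
  case/properP: pw' => _ [i iw' is0]; case/negP: is0; rewrite -vertb// inE.
  move: iw'; rewrite inE e' map_line; last exact: (cell_map hC).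
  set k := u / u' => /eqP h.
  have k0 : 0 < k by rewrite divr_gt0.
  have k1 : k < 1 by rewrite ltr_pdivrMr// mul1r.
  have h1 := (center_inside hb s0).2 i; have h2 := (barycenter_inside Dw).2 i.
  have h3 : 0 <= k * y i (beta w) by rewrite mulr_ge0// ltW.
  have h4 : 0 <= (1 - k) * y i (b s0) by rewrite mulr_ge0// subr_ge0 ltW.
  have : (1 - k) * y i (b s0) = 0 by apply/eqP; rewrite eq_le h4 andbT; nra.
  by move/eqP; rewrite mulf_eq0 subr_eq0 gt_eqF.
have u0 : 0 < 1 - t s0 by rewrite subr_gt0.
have u0' : 0 < 1 - t' s0 by rewrite subr_gt0.
have /eqP uE : 1 - t s0 == 1 - t' s0.
  rewrite eq_le; apply/andP; split; rewrite leNgt; apply/negP => h.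
    exact: noteq Dv' Dv pv u0' h (esym E).
  exact: noteq Dv Dv' pv' u0 h E.
have vv' : v = v'.
  apply: IH => //.
    have := tn; rewrite ltnS; apply: leq_trans; apply: proper_card.
    by rewrite properC.
  move: E; rewrite uE => /(scalerI (lt0r_neq0 u0')).
  exact: addIr.
have tsE : t s0 = t' s0 by apply: oppr_inj; exact: addrI uE.
by apply/funext => s; rewrite hv hv' vv' tsE.
Qed.

End Barycentric.
End Cells.

(** * Polytopes *)

Lemma small_step (R : realFieldType) (T : finType) (a d : T -> R) :
  (forall j, 0 < a j) -> exists2 e, 0 < e & forall j, 0 < a j + e * d j.
Proof.
move=> a0; pose S := \sum_j `|d j| / a j.
have S0 : 0 <= S by apply: sumr_ge0 => j _; rewrite divr_ge0// ltW.
have S1 : 0 < 1 + S by rewrite ltr_pwDl.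
exists (1 + S)^-1; first by rewrite invr_gt0.
move=> j; rewrite mulrC.
have dS : `|d j| / a j <= S.
  by rewrite /S (bigD1 j)//= lerDl sumr_ge0// => k _; rewrite divr_ge0// ltW.
have : `|d j| < (1 + S) * a j.
  by rewrite -ltr_pdivrMr// (le_lt_trans dS)// ltrDr.
move=> dlt; have : `|d j / (1 + S)| < a j.
  by rewrite normrM normfV (gtr0_norm S1) ltr_pdivrMr// mulrC.
by rewrite ltr_norml => /andP[h _]; rewrite -ltrBlDl sub0r.
Qed.

(** * Slack functions and affine hulls *)

Section Slack.
Context {R : realType} {N : nat}.
Notation V := 'rV[R]_N.
Implicit Types (A P : set V) (x z : V).

Definition slack (h : 'cV[R]_N) (c : R) x : R := c - (x *m h) 0 0.

Lemma slack_affine h c : affine_map (slack h c).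
Proof.
move=> T t p t1; rewrite /slack mulmx_suml summxE.
under [RHS]eq_bigr do rewrite mulrBr.
rewrite sumrB -mulr_suml t1 mul1r; congr (_ - _); apply: eq_bigr => j _.
by rewrite -scalemxAl mxE.
Qed.

Lemma slackD h c x z : slack h c (x + z) = slack h c x - (z *m h) 0 0.
Proof. by rewrite /slack mulmxDl mxE opprD addrA. Qed.

Lemma sub_aff_hull A : A `<=` aff_hull A.
Proof.
move=> x Ax; exists 1%N, (fun=> x), (fun=> 1); split=> //.
  by rewrite big_ord1.
by rewrite big_ord1 scale1r.
Qed.

Lemma aff_hull_comb A (T : finType) (t : T -> R) (p : T -> V) :
  \sum_j t j = 1 -> (forall j, A (p j)) -> aff_hull A (\sum_j t j *: p j).
Proof.
move=> t1 Ap; exists #|T|, (p \o enum_val), (t \o enum_val); split=> [i||] /=.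
- exact: Ap.
- by rewrite -t1 (reindex _ (onW_bij _ (@enum_val_bij T))).
- by rewrite (reindex _ (onW_bij _ (@enum_val_bij T))).
Qed.

Lemma aff_hull_line A x z s : A x -> A z -> aff_hull A (x + s *: (z - x)).
Proof.
by move=> Ax Az; rewrite lineE; apply: aff_hull_comb => [|[]//]; rewrite big_bool /=; ring.
Qed.

Lemma aff_hull_sub A B x : A `<=` B -> aff_hull A x -> aff_hull B x.
Proof. by move=> AB [k [y [c [Ay c1 xE]]]]; exists k, y, c; split=> // i; apply: AB. Qed.

Lemma affine_map_eq0 (f : V -> R) A x : affine_map f ->
  (forall z, A z -> f z = 0) -> aff_hull A x -> f x = 0.
Proof.
move=> hf fA [k [y [c [Ay c1 ->]]]]; rewrite hf// big1// => i _.
by rewrite fA ?mulr0.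
Qed.

Lemma aff_dim_dir A d : aff_dim A d -> exists W : {vspace V},
  [/\ \dim W = d, exists x, A x
    & forall x z, aff_hull A x -> (aff_hull A z <-> z - x \in W)].
Proof.
move=> [x0 [W [dW AE]]]; have hE z : aff_hull A z <-> z - x0 \in W.
  rewrite AE; split=> [[v /= Wv <-]|Wz]; first by rewrite addrAC subrr add0r.
  by exists (z - x0) => //; rewrite addrC subrK.
exists W; split=> //; last first.
  move=> x z /hE xW; rewrite hE.
  have -> : z - x0 = (z - x) + (x - x0) by rewrite addrA subrK.
  by rewrite rpredDr.
have : aff_hull A x0 by rewrite hE subrr mem0v.
case=> -[|k] [y [c [Ay c1 _]]]; last by exists (y ord0).
by move: c1; rewrite big_ord0 => /eqP; rewrite eq_sym oner_eq0.
Qed.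

Lemma aff_dim_closed A d : aff_dim A d -> affine_closed (aff_hull A).
Proof.
move=> /aff_dim_dir[W [_ [a Aa] hW]] T t p t1 ap.
have ha := sub_aff_hull Aa.
apply/(hW _ _ ha); rewrite -[X in _ - X]scale1r -t1 scaler_suml -sumrB.
by apply: memv_suml => j _; rewrite -scalerBr memvZ//; apply/(hW _ _ ha).
Qed.

Lemma hyperplane_dim (W : {vspace V}) (h : 'cV[R]_N) u :
  u \in W -> (u *m h) 0 0 != 0 ->
  exists W' : {vspace V}, (\dim W' + 1 = \dim W)%N /\
    forall v, v \in W' <-> v \in W /\ (v *m h) 0 0 = 0.
Proof.
move=> uW uh; pose f := linfun (mulmxr h : V -> 'M[R]_1).
have fE v : f v = v *m h by rewrite lfunE.
exists (W :&: lker f)%VS; split; last first.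
  move=> v; rewrite memv_cap memv_ker fE; split=> [/andP[vW /eqP ->]|[-> vh]].
    by rewrite mxE.
  by apply/eqP/matrixP => i j; rewrite !ord1 vh mxE.
rewrite -(limg_ker_dim f W); congr (_ + _)%N; apply/esym/eqP; rewrite eqn_leq.
apply/andP; split.
  by apply: leq_trans (dimvS (subvf _)) _; rewrite dimvf.
rewrite lt0n dimv_eq0; apply: contraNneq uh => f0.
have := memv_img f uW; rewrite f0 memv0 fE => /eqP ->; rewrite mxE//.
Qed.

End Slack.

(** * Irredundant systems of inequalities and their walls *)

Section HalfSpaces.
Context {R : realType} {N n : nat}.
Notation V := 'rV[R]_N.
Variables (P : set V) (T : finType) (h : T -> 'cV[R]_N) (c : T -> R).
Local Notation g k := (slack (h k) (c k)).
Hypothesis PE : forall x, P x <-> forall k, 0 <= g k x.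
Hypothesis Pn : aff_dim P n.

(** Redundancy is tested inside the affine hull, so an inequality that is an equality on all of [P]
    is never kept: it cannot be violated on the hull. *)
Definition irredundant (I : {set T}) : Prop :=
  (forall x, aff_hull P x -> (forall k, k \in I -> 0 <= g k x) -> P x) /\
  (forall k, k \in I -> exists x, [/\ aff_hull P x, g k x < 0 &
     forall j, j \in I -> j != k -> 0 <= g j x]).

Lemma irredundant_ex : exists I, irredundant I.
Proof.
pose ok (I : {set T}) := `[< forall x, aff_hull P x -> (forall k, k \in I -> 0 <= g k x) -> P x >].
have okT : ok [set: T]%SET by apply/asboolP => x _ h0; apply/PE => k; apply: h0; rewrite inE.
case: (@arg_minnP _ _ ok (fun I => #|I|) okT) => I /asboolP Iok Imin.
exists I; split=> // k kI; apply: contrapT => hk.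
have : ok (I :\ k)%SET.
  apply/asboolP => x ax h0; apply: Iok => // j jI.
  have [->|jk] := eqVneq j k; last by apply: h0; rewrite !inE jk.
  rewrite leNgt; apply/negP => gx; apply: hk; exists x; split=> // i iI ik.
  by apply: h0; rewrite !inE ik.
by move=> /Imin; rewrite (cardsD1 k I) kI add1n ltnn.
Qed.

Variable I : {set T}.
Hypothesis hI : irredundant I.

(** Each kept inequality is strict somewhere on [P], since otherwise it would be an equality on the
    hull; midpoints make finitely many of them strict at once. *)
Lemma positive_point : exists2 x, P x & forall k, k \in I -> 0 < g k x.
Proof.
have aP : affine_closed (aff_hull P) := aff_dim_closed Pn.
have [_ [_ [p0 Pp0] _]] := aff_dim_dir Pn.
have pt k : k \in I -> exists2 x, P x & 0 < g k x.
  move=> kI; apply: contrapT => hk; have [x [ax gx _]] := hI.2 k kI.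
  suff : g k x = 0 by move=> g0; rewrite g0 ltxx in gx.
  apply: (affine_map_eq0 (slack_affine _ _) _ ax) => z Pz.
  apply/eqP; rewrite eq_le (PE z).1// andbT leNgt; apply/negP => gz.
  by apply: hk; exists z.
suff : forall s : seq T, exists2 x, P x & forall k, k \in I -> k \in s -> 0 < g k x.
  move=> /(_ (enum T))[x Px h0]; exists x => // k kI.
  by apply: h0; rewrite ?mem_enum.
elim=> [|k s [x Px hx]]; first by exists p0.
have [kI|kI] := boolP (k \in I); last first.
  exists x => // j jI; rewrite inE => /orP[/eqP jk|]; last exact: hx.
  by rewrite -jk jI in kI.
have [z Pz gz] := pt k kI.
have gE j : g j (x + 2^-1 *: (z - x)) = 2^-1 * g j x + 2^-1 * g j z.
  by rewrite map_line; [field|exact: slack_affine].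
have x0 j := (PE x).1 Px j; have z0 j := (PE z).1 Pz j.
have i2 : 0 < 2^-1 :> R by rewrite invr_gt0.
exists (x + 2^-1 *: (z - x)).
  by apply/PE => j; rewrite gE addr_ge0// mulr_ge0// ltW.
move=> j jI; rewrite gE inE => /orP[/eqP ->|js].
  by rewrite ltr_wpDl ?mulr_gt0// mulr_ge0// ltW.
by rewrite ltr_pwDl ?mulr_gt0 ?hx// mulr_ge0// ltW.
Qed.

Let wall k : set V := P `&` [set x | (x *m h k) 0 0 = c k].

Lemma wallE k x : wall k x <-> P x /\ g k x = 0.
Proof.
rewrite /slack; split=> -[Px /= e]; split=> //=; first by rewrite e subrr.
by apply/esym/eqP; rewrite -subr_eq0; apply/eqP.
Qed.

(** The segment from a point [q] with positive kept slacks to a point [z] violating only [k] crosses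
    the wall at [p], where the other kept slacks are positive. So [p] can be moved slightly towards
    [x] within the wall, and [x] lies on the line through [p] and the moved point. *)
Lemma aff_hull_wall k x : k \in I -> aff_hull P x -> g k x = 0 -> aff_hull (wall k) x.
Proof.
move=> kI ax gx.
have [q Pq q0] := positive_point.
have [z [az gz zj]] := hI.2 k kI.
have aP : affine_closed (aff_hull P) := aff_dim_closed Pn.
have aq := sub_aff_hull Pq.
have d0 : 0 < g k q - g k z by rewrite subr_gt0 (lt_trans gz) ?q0.
pose s := g k q / (g k q - g k z).
have s0 : 0 < s by rewrite divr_gt0 ?q0.
have s1 : s < 1 by rewrite ltr_pdivrMr// mul1r ltrDl oppr_gt0.
pose p := q + s *: (z - q).
have gp j : g j p = (1 - s) * g j q + s * g j z.
  by rewrite /p map_line; [ring|exact: slack_affine].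
have gpk : g k p = 0 by rewrite gp /s; field; rewrite gt_eqF.
have gpj j : j \in I -> j != k -> 0 < g j p.
  move=> jI jk; rewrite gp; apply: ltr_pwDl.
    by apply: mulr_gt0; [rewrite subr_gt0|exact: q0].
  by rewrite mulr_ge0 ?zj// ltW.
have ap : aff_hull P p by apply: aff_line.
have Pp : P p.
  apply: hI.1 => // j jI; have [->|jk] := eqVneq j k; first by rewrite gpk.
  by rewrite ltW ?gpj.
have [e e0 he] : exists2 e : R, 0 < e & forall j, 0 < (if j \in I :\ k then g j p else 1)%SET
    + e * (g j x - g j p).
  by apply: small_step => j; case: ifPn => //; rewrite !inE => /andP[? ?]; apply: gpj.
pose r := p + e *: (x - p).
have gr j : g j r = g j p + e * (g j x - g j p).
  by rewrite /r map_line//; exact: slack_affine.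
have wr : wall k r.
  apply/wallE; rewrite gr gpk gx subrr mulr0 addr0; split=> //.
  apply: hI.1 => [|j jI]; first exact: aff_line.
  rewrite gr; have [->|jk] := eqVneq j k; first by rewrite gpk gx subrr mulr0 addr0.
  by have := he j; rewrite !inE jk jI => /ltW.
have -> : x = p + e^-1 *: (r - p).
  by rewrite /r [p + e *: _]addrC addrK scalerA mulVf ?gt_eqF// scale1r addrC subrK.
by apply: aff_hull_line => //; apply/wallE.
Qed.

(** The direction [z - q] is transverse to the hyperplane, so the section has dimension exactly one
    less, and by [aff_hull_wall] the wall spans all of it. *)
Lemma facet_wall k : k \in I -> facet P (wall k).
Proof.
move=> kI; split.
  exists (h k), (c k); split=> // x /PE/(_ k); by rewrite subr_ge0.
have [q Pq q0] := positive_point.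
have [z [az gz zj]] := hI.2 k kI.
have [W [dW _ hW]] := aff_dim_dir Pn.
have aq := sub_aff_hull Pq.
pose s := g k q / (g k q - g k z).
have d0 : 0 < g k q - g k z by rewrite subr_gt0 (lt_trans gz) ?q0.
pose p := q + s *: (z - q).
have ap : aff_hull P p by apply: aff_line => //; exact: aff_dim_closed Pn.
have gpk : g k p = 0.
  by rewrite /p map_line; [rewrite /s; field; rewrite gt_eqF|exact: slack_affine].
have zqW : z - q \in W by apply/(hW _ _ aq).
have [|W' [dW' hW']] := hyperplane_dim (h := h k) zqW.
  have := d0; rewrite subr_gt0 -[z in slack _ _ z](subrK q) addrC slackD.
  by rewrite ltrBlDr ltrDl => /gt_eqF ->.
exists (\dim W'); split; last by rewrite dW' dW.
exists p, W'; split=> //; apply/seteqP; split=> [x xA|_ [v /= /hW'[vW vh] <-]].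
  exists (x - p); last by rewrite addrC subrK.
  have ax : aff_hull P x by apply: aff_hull_sub xA => ? [].
  have gx : g k x = 0.
    by apply: (affine_map_eq0 (slack_affine _ _) _ xA) => ? /wallE[].
  apply/hW'; split; first by apply/(hW _ _ ap).
  move: gx; rewrite -[x in slack _ _ x](subrK p) addrC slackD gpk.
  by move/eqP; rewrite sub0r oppr_eq0 => /eqP.
apply: aff_hull_wall => //; last by rewrite slackD gpk vh subrr.
by apply/(hW _ _ ap); rewrite addrAC subrr add0r.
Qed.

End HalfSpaces.

(* After discarding redundant inequalities, each remaining one supports a facet. *)
Lemma polytope_facets (R : realType) (N n : nat) (P : set 'rV[R]_N) (T : finType)
    (h : T -> 'cV[R]_N) (c : T -> R) :
  polytope P -> aff_dim P n ->
  (forall A, facet P A -> exists i, A = P `&` [set x | (x *m h i) 0 0 = c i]) ->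
  (forall i x, P x -> 0 <= slack (h i) (c i) x) ->
  forall x, P x <-> inside (aff_hull P) (fun i => slack (h i) (c i)) x.
Proof.
move=> [_ [K [H [b PHb]]]] Pn facetP slack0 x.
pose hH k := col k H; pose g k := slack (hH k) (b 0 k).
have gE k z : g k z = b 0 k - (z *m H) 0 k.
  by rewrite /g /slack /hH !mxE; congr (_ - _); apply: eq_bigr => j _; rewrite !mxE.
have PE z : P z <-> forall k, 0 <= g k z.
  by rewrite PHb /=; split=> h0 k; have := h0 k; rewrite gE subr_ge0.
have [I hI] := irredundant_ex PE.
split=> [Px|[ax y0]]; first by split=> [|i]; [exact: sub_aff_hull|exact: slack0].
apply: hI.1 => // k kI; rewrite leNgt; apply/negP => gx.
have [q Pq q0] := positive_point PE Pn hI.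
have aq := sub_aff_hull Pq.
have [i wE] := facetP _ (facet_wall PE Pn hI kI).
have d0 : 0 < g k q - g k x by rewrite subr_gt0 (lt_trans gx) ?q0.
pose s := g k q / (g k q - g k x).
have s0 : 0 < s by rewrite divr_gt0 ?q0.
have s1 : s < 1 by rewrite ltr_pdivrMr// mul1r ltrDl oppr_gt0.
(* The segment meets the wall of [k] at [p], strictly between [q] and [x]. This wall is also that of
   some given slack [i], which is positive at [q] and zero at [p], hence negative at [x]. *)
pose p := q + s *: (x - q).
have ap : aff_hull P p by apply: aff_line => //; exact: aff_dim_closed Pn.
have gp : g k p = 0.
  by rewrite /p map_line; [rewrite /s -/(g k); field; rewrite gt_eqF|exact: slack_affine].
have wp := aff_hull_wall PE Pn hI kI ap gp.
have yp : slack (h i) (c i) p = 0.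
  apply: (affine_map_eq0 (slack_affine _ _) _ wp) => z; rewrite wE => -[_ /= <-].
  by rewrite /slack subrr.
have yq : 0 < slack (h i) (c i) q.
  rewrite lt_neqAle slack0// andbT eq_sym; apply/eqP => yq0.
  have : (P `&` [set x | (x *m hH k) 0 0 = b 0 k]) q.
    by rewrite wE; split=> //=; apply/esym/eqP; rewrite -subr_eq0; apply/eqP.
  by move=> [_ /= qk]; have := q0 k kI; rewrite /slack qk subrr ltxx.
move: yp; rewrite /p map_line; last exact: slack_affine.
have := y0 i; nra.
Qed.

Lemma slack_continuous (R : realType) N (h : 'cV[R]_N) (c : R) : continuous (slack h c).
Proof.
move=> x; have -> : slack h c = fun z => c - \sum_k z 0 k * h k 0.
  by apply/funext => z; rewrite /slack mxE.
have E : continuous (fun z : 'rV[R]_N => \sum_k z 0 k * h k 0).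
  apply: continuous_big => [|k _ z]; first exact: add_continuous.
  apply: (@cvgM _ _ (nbhs z)); first exact: coord_continuous.
  exact: (@cvg_cst _ _ _ (nbhs z)).
apply: (@cvgB _ _ _ (nbhs x)); last exact: E.
exact: (@cvg_cst _ _ _ (nbhs x)).
Qed.

(** * Simple polytopes as cells; centers, vertices and carrier faces *)

Section SimplePolytopes.
Context {R : realType} {N n m : nat}.
Notation V := 'rV[R]_N.
Context {P : set V} {F : 'I_m -> set V}.

Lemma facet_slacks : simple_polytope n P F ->
  exists (h : 'I_m -> 'cV[R]_N) (c : 'I_m -> R),
    (forall i x, P x -> 0 <= slack (h i) (c i) x) /\
    (forall i x, F i x <-> P x /\ slack (h i) (c i) x = 0).
Proof.
move=> [_ _ [_ FP] _].
have Fi i : exists hc : 'cV[R]_N * R, (forall x, P x -> (x *m hc.1) 0 0 <= hc.2) /\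
    F i = P `&` [set x | (x *m hc.1) 0 0 = hc.2].
  have [|[h [c hc]] _] := (FP (F i)).2; first by exists i.
  by exists (h, c).
have [hc hcP] := choice Fi.
exists (fun i => (hc i).1), (fun i => (hc i).2); split=> [i x Px|i x].
  by rewrite subr_ge0; apply: (hcP i).1.
rewrite (hcP i).2 /slack; split=> -[Px /= e]; split=> //=.
  by apply/eqP; rewrite subr_eq0 e.
by apply/esym/eqP; rewrite -subr_eq0; apply/eqP.
Qed.

Variables (h : 'I_m -> 'cV[R]_N) (c : 'I_m -> R).
Hypothesis sP : simple_polytope n P F.
Local Notation y := (fun i => slack (h i) (c i)).
Hypothesis y0 : forall i x, P x -> 0 <= y i x.
Hypothesis FE : forall i x, F i x <-> P x /\ y i x = 0.

Lemma simple_polytopeE x : P x <-> inside (aff_hull P) y x.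
Proof.
have [pP dP [_ FP] _] := sP; apply: (polytope_facets pP dP) => // A /FP[i <-].
exists i; apply/seteqP; split=> x'; rewrite FE /slack => -[Px /= e]; split=> //=.
  by apply/esym/eqP; rewrite -subr_eq0; apply/eqP.
by apply/eqP; rewrite subr_eq0 e.
Qed.

Lemma simple_polytope_cell : cell (aff_hull P) y.
Proof.
have [[bP _] dP _ _] := sP; split.
- exact: aff_dim_closed dP.
- by move=> i; exact: slack_affine.
move=> x z hx az xz; apply: contrapT => hn.
have yz i : y i x <= y i z.
  by rewrite leNgt; apply/negP => yi; apply: hn; exists i.
have ray s : 0 <= s -> P (x + s *: (z - x)).
  move=> s0; apply/simple_polytopeE; split=> [|i].
    by apply: aff_line => //; [exact: aff_dim_closed dP|case: hx].
  rewrite map_line; last exact: slack_affine.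
  by rewrite addr_ge0 ?hx.2// mulr_ge0// subr_ge0; exact: yz.
have [M M0 hM] := ex_strict_bound_gt0 bP.
have d0 : 0 < `|z - x| by rewrite normr_gt0 subr_eq0 eq_sym.
(* A displacement of length [2 M] cannot join two points of norm less than [M]. *)
have s0 : 0 <= 2 * M / `|z - x| by rewrite divr_ge0// mulr_ge0// ltW.
have := hM _ (ray _ s0); have := hM _ (ray _ (lexx _)); rewrite /= scale0r addr0.
move=> xM sM.
have : `|(2 * M / `|z - x|) *: (z - x)| < 2 * M.
  rewrite -[_ *: _](addrK x) addrC (le_lt_trans (ler_normD _ _))// normrN.
  by rewrite addrC [X in _ < X]mulr_natl mulr2n ltrD// addrC.
by rewrite normrZ normrM normfV normr_id divfK ?gt_eqF// ger0_norm ?ltxx// mulr_ge0// ltW.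
Qed.

Lemma facet_interE s x : facet_inter P F s x <-> P x /\ s \subset zeros y x.
Proof.
split=> -[Px h0]; split=> //.
  by apply/fintype.subsetP => i /h0/FE[_ yi]; rewrite inE yi.
by move=> i /(fintype.subsetP h0); rewrite inE => /eqP yi; apply/FE.
Qed.

(** The sum of the inequalities in [s] supports this face: a sum of nonnegative slacks vanishes only
    where all of them do. *)
Lemma face_facet_inter s : face P (facet_inter P F s).
Proof.
exists (\sum_(i in s) h i), (\sum_(i in s) c i).
have hE x : \sum_(i in s) c i - (x *m \sum_(i in s) h i) 0 0 = \sum_(i in s) y i x.
  by rewrite mulmx_sumr summxE -sumrB.
split=> [x Px|].
  by rewrite -subr_ge0 hE; apply: sumr_ge0 => i _; exact: y0.
apply/seteqP; split=> x.
  move=> /facet_interE[Px sx]; split=> //=; apply/esym/eqP; rewrite -subr_eq0 hE.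
  apply/eqP; apply: big1 => i /(fintype.subsetP sx); by rewrite inE => /eqP.
move=> [Px /= /esym/eqP]; rewrite -subr_eq0 hE psumr_eq0 => [/allP hs|i _]; last exact: y0.
apply/facet_interE; split=> //; apply/fintype.subsetP => i si.
by have := hs i (mem_index_enum _); rewrite si inE.
Qed.

Lemma vertex_facets v : P v ->
  (forall z, aff_hull P z -> zeros y v \subset zeros y z -> z = v) ->
  facet_inter P F (zeros y v) = [set v] /\ #|zeros y v| = n.
Proof.
move=> Pv hv; have E : facet_inter P F (zeros y v) = [set v].
  apply/seteqP; split=> x; first by move=> /facet_interE[/sub_aff_hull/hv].
  by move=> ->; apply/facet_interE.
split=> //; have [_ _ _ vn] := sP; rewrite -(vn v); last by rewrite -E; exact: face_facet_inter.
apply: eq_card => i; rewrite !inE; apply/eqP/asboolP => [yi|/FE[]//].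
exact/FE.
Qed.

(** By simplicity, the [n] slacks vanishing at a vertex of the face are independent linear forms on
    the [n]-dimensional direction space. So some direction keeps those in [s] at zero and lets the
    others grow. *)
Lemma simple_polytope_center s : facet_inter P F s !=set0 ->
  exists2 x, P x & zeros y x = s.
Proof.
move=> [x /facet_interE[Px sx]].
have [v [hv xv vz]] := cell_vertex simple_polytope_cell ((simple_polytopeE x).1 Px).
have Pv : P v by apply/simple_polytopeE.
have [_ vn] := vertex_facets Pv vz.
have sv := fintype.subset_trans sx xv.
have [_ dP _ _] := sP; have [W [dW _ hW]] := aff_dim_dir dP.
have av := sub_aff_hull Pv.
set Z := zeros y v in vn sv vz.
pose M : 'M[R]_(N, #|Z|) := \matrix_(a, j) h (enum_val j) a 0.
have ME u j : (u *m M) 0 j = (u *m h (enum_val j)) 0 0.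
  by rewrite !mxE; apply: eq_bigr => a _; rewrite mxE.
pose f := linfun (mulmxr M : V -> 'rV[R]_#|Z|).
have fE u : f u = u *m M by rewrite lfunE.
(* A direction killed by all these forms leads from [v] to a point with at least the same zeros,
   that is, to [v]. Injectivity and [#|Z| = n] then give surjectivity. *)
have kf : (W :&: lker f)%VS = 0%VS.
  apply/eqP; rewrite -subv0; apply/subvP => u; rewrite memv_cap memv_ker memv0 fE.
  move=> /andP[uW /eqP uM]; apply/eqP/(@addrI _ v); rewrite addr0; apply: vz.
    by apply/(hW _ _ av); rewrite addrAC subrr add0r.
  apply/fintype.subsetP => i iZ; have := iZ; rewrite !inE => /eqP yi.
  by rewrite slackD yi sub0r oppr_eq0 -(enum_rankK_in iZ iZ) -ME uM mxE.
have fW : (f @: W)%VS = fullv.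
  apply/eqP; rewrite eqEdim subvf dimvf dim_matrix /=.
  have := limg_ker_dim f W; rewrite kf dimv0 add0n dW => ->.
  by rewrite -[X in (_ <= X)%N]vn -[X in (_ <= X)%N]mul1n.
(* A slack is a constant minus the linear form, so the value -1 makes it grow. *)
pose tau : 'rV[R]_#|Z| := \row_j (if enum_val j \in s then 0 else -1).
have [u uW uM] : exists2 u, u \in W & tau = u *m M.
  have /memv_imgP[u uW ->] : tau \in (f @: W)%VS by rewrite fW memvf.
  by exists u => //; rewrite fE.
have hu i : i \in Z -> (u *m h i) 0 0 = if i \in s then 0 else -1.
  by move=> iZ; rewrite -{1}(enum_rankK_in iZ iZ) -ME -uM mxE enum_rankK_in.
have [e e0 he] : exists2 e : R, 0 < e & forall j, 0 < (if j \in Z then 1 else y j v)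
    + e * (- (u *m h j) 0 0).
  apply: small_step => j; case: ifPn => // jZ; rewrite lt_neqAle y0// andbT.
  by move: jZ; rewrite inE eq_sym.
have yE j : y j (v + e *: u) = y j v - e * (u *m h j) 0 0.
  by rewrite slackD -scalemxAl mxE.
have ye j : y j (v + e *: u) == 0 = (j \in s) /\ 0 <= y j (v + e *: u).
  rewrite yE; have [jZ|jZ] := boolP (j \in Z).
    have /eqP -> : y j v == 0 by move: jZ; rewrite inE.
    rewrite hu// sub0r; case: ifPn => js; first by rewrite mulr0 oppr0 eqxx.
    by rewrite mulrN1 opprK gt_eqF// ltW.
  have := he j; rewrite (negPf jZ) mulrN => h1; rewrite ltW// gt_eqF//.
  by split=> //; apply/esym; apply: contraNF jZ; exact: (fintype.subsetP sv).
exists (v + e *: u).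
  apply/simple_polytopeE; split=> [|j]; last by case: (ye j).
  by apply/(hW _ _ av); rewrite addrAC subrr add0r memvZ.
by apply/setP => j; rewrite inE; case: (ye j).
Qed.

Lemma simple_polytope_centers :
  exists b, centers (aff_hull P) y (dual_complex P F) b.
Proof.
have [_ dP _ _] := sP; have [_ [_ [p0 Pp0] _]] := aff_dim_dir dP.
have /choice[b hb] : forall s, exists x, P x /\ (dual_complex P F s -> zeros y x = s).
  move=> s; have [/simple_polytope_center[x Px xs]|hs] := pselect (dual_complex P F s).
    by exists x.
  by exists p0.
exists b; split=> [s|s /(hb s).2//|x /simple_polytopeE Px].
- by apply/simple_polytopeE; case: (hb s).
- by exists x; apply/facet_interE.
Qed.

(** At a vertex, the condition on a characteristic function gives a set of columns of rank [n]. *)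
Lemma simple_polytope_vertex :
  exists2 s : {set 'I_m}, codim_face P #|s| (facet_inter P F s) & #|s| = n.
Proof.
have [_ dP _ _] := sP; have [_ [_ [p0 Pp0] _]] := aff_dim_dir dP.
have [v [hv _ vz]] := cell_vertex simple_polytope_cell ((simple_polytopeE p0).1 Pp0).
have Pv : P v by apply/simple_polytopeE.
have [Fv vn] := vertex_facets Pv vz.
exists (zeros y v) => //; split; first exact: face_facet_inter.
exists 0%N; rewrite vn add0n; split=> //; rewrite Fv.
exists v, 0%VS; rewrite dimv0; split=> //; apply/seteqP; split=> [x|_ [x /= x0 <-]].
  move=> [k [p [t [pv t1 ->]]]]; exists 0; first by rewrite /= mem0v.
  by rewrite addr0 (eq_bigr (fun i => t i *: v)) => [|i _]; rewrite -?scaler_suml ?t1 ?scale1r// pv.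
by move: x0; rewrite memv0 => /eqP ->; rewrite addr0; exact: sub_aff_hull.
Qed.

(** [carrier_face] is a choice, so a candidate is needed: the intersection of the facets through
    [p]. Their slacks vanish on its affine hull, and the remaining ones, positive at [p], stay
    positive nearby. *)
Lemma carrier_face_spec p : P p ->
  face P (carrier_face P p) /\ rel_interior (carrier_face P p) p.
Proof.
move=> Pp; apply: (@xgetPex _ set0 [set A | face P A /\ rel_interior A p]).
exists (facet_inter P F (zeros y p)); split; first exact: face_facet_inter.
split; first exact/facet_interE.
have near0 j : \forall z \near p, j \notin zeros y p -> 0 < y j z.
  have [jp|jp] := boolP (j \in zeros y p).
    by apply: (@filterE _ (nbhs p)) => z.
  have yp : 0 < y j p.
    by rewrite lt_neqAle y0// andbT; move: jp; rewrite inE eq_sym.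
  apply: (@filterS _ (nbhs p)) (slack_continuous (h := h j) (c := c j) (lt_nbhsr yp)).
  by [].
apply: (@filterS _ (nbhs p)) (@filter_forall _ _ _ (nbhs p) _ near0) => z zp az.
have y00 j : j \in zeros y p -> y j z = 0.
  move=> jp; apply: (affine_map_eq0 (slack_affine _ _) _ az) => z' /facet_interE[_].
  by move=> /fintype.subsetP/(_ j jp); rewrite inE => /eqP.
apply/facet_interE; split; last by apply/fintype.subsetP => j /y00 yj; rewrite inE yj.
apply/simple_polytopeE; split=> [|j]; first by apply: aff_hull_sub az => ? [].
by have [/y00 ->//|jp] := boolP (j \in zeros y p); rewrite ltW// zp.
Qed.

(** Suppose a slack vanishes at [p] but not at a point [a] of the carrier face. A small move from
    [p] away from [a] stays in the face, [p] being in its relative interior, and makes the slack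
    negative. *)
Lemma carrier_face_facet p i : P p -> carrier_face P p `<=` F i <-> F i p.
Proof.
move=> Pp; have [fA [Ap hA]] := carrier_face_spec Pp.
split=> [|/FE[_ yp] a Aa]; first exact.
set A := carrier_face P p in fA Ap hA Aa.
have AP : A `<=` P by case: fA => ? [? [_ ->]] ? [].
have lc : {for (0 : R), continuous (fun e : R => p + (- e) *: (a - p))}.
  apply: cvgD; first exact: cvg_cst.
  by apply: cvgZl; apply: cvgN; exact: cvg_id.
have /nbhs_ballP[d /= d0 hd] : nbhs (0 : R) ((fun e : R => p + (- e) *: (a - p)) @^-1`
    [set z | aff_hull A z -> A z]).
  by apply: lc; rewrite /= oppr0 scale0r addr0.
have := hd (d / 2); rewrite /ball /= sub0r normrN gtr0_norm ?divr_gt0//.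
rewrite ltr_pdivrMr// ltr_pMr// ltr1n => /(_ isT (aff_hull_line _ Ap Aa))/AP /y0 => /(_ i).
rewrite map_line; last exact: slack_affine.
rewrite yp subr0 add0r mulNr oppr_ge0 pmulr_rle0 ?divr_gt0// => ya.
apply/FE; split; first exact: AP.
by apply/eqP; rewrite eq_le ya y0//; apply: AP.
Qed.

End SimplePolytopes.

(** * The complex K(J) and the polytope P(J) *)

Section Blocks.
Context {I T : finType} (blk : T -> I).

Definition full_blocks (u : {set T}) : {set I} :=
  finset (fun i => [forall v, (blk v == i) ==> (v \in u)]).

Lemma full_blocksP (u : {set T}) i :
  reflect (forall v, blk v = i -> v \in u) (i \in full_blocks u).
Proof.
rewrite inE; apply: (iffP forallP) => [h v /eqP vi|h v]; first by have := h v; rewrite vi.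
by apply/implyP => /eqP; exact: h.
Qed.

Lemma sub_full_blocks (s : {set I}) (u : {set T}) :
  (s \subset full_blocks u) = (finset (fun v => blk v \in s) \subset u).
Proof.
apply/fintype.subsetP/fintype.subsetP => [h v|h i si].
  by rewrite inE => /h/full_blocksP; apply.
by apply/full_blocksP => v vi; apply: h; rewrite inE vi.
Qed.

End Blocks.

Lemma minimal_nonface_ex (T : finType) (K : set {set T}) (s : {set T}) : ~ K s ->
  exists2 s' : {set T}, s' \subset s & minimal_nonface K s'.
Proof.
move=> Ks; have [n] := ubnP #|s|; elim: n s Ks => // n IH s Ks sn.
have [h|] := pselect (forall t : {set T}, t \proper s -> K t); first by exists s.
move=> /existsNP[t /not_implyP[ts Kt]].
have [|s' s't ms'] := IH t Kt; first by rewrite (leq_trans (proper_card ts)).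
by exists s' => //; apply: fintype.subset_trans (proper_sub ts).
Qed.

(** A non-face contains a minimal one. In K(J) this is the union of the blocks of a minimal non-face
    of [K], and [u] contains such a union iff [full_blocks] of [u] contains that non-face. *)
Lemma is_KJE (m : nat) (J : 'I_m -> nat) (K : set {set 'I_m})
    (L : set {set 'I_(extra J + m)}) : simplicial_complex K -> is_KJ K L ->
  forall u, L u <-> K (full_blocks (vertex_block J) u).
Proof.
move=> [_ Kd] [[_ Ld] mL] u; split=> [Lu|Ku]; apply: contrapT => n.
  have [s su ms] := minimal_nonface_ex n; rewrite sub_full_blocks in su.
  have [nLs _] : minimal_nonface L (finset (fun v => vertex_block J v \in s)).
    by apply/mL; exists s.
  exact/nLs/(Ld _ _ su Lu).
have [u' uu' mu'] := minimal_nonface_ex n.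
have /mL[s [nKs _] u'E] := mu'; rewrite u'E -sub_full_blocks in uu'.
exact/nKs/(Kd _ _ uu' Ku).
Qed.

(** * A polytope of pairs (x, w) with dual complex K(J) *)

Section Wedge.
Context {R : realFieldType} {V : lmodType R} {I T : finType} (blk : T -> I).
Context (aff : set V) (y : I -> V -> R) (K : set {set I}) (b : {set I} -> V).
Local Notation V' := (V * {ffun T -> R^o})%type.

(* Models P(J): over a point [x] of P, the [i]-th slack is distributed
   among the [j_i] coordinates of the block [i]. *)
Definition wedge_aff : set V' :=
  [set x : V' | aff x.1 /\ forall i, \sum_(v | blk v == i) x.2 v = y i x.1].

Definition wedge_coord (v : T) (x : V') : R := x.2 v.

Lemma sum_fst (A : finType) (t : A -> R) (p : A -> V') :
  (\sum_j t j *: p j).1 = \sum_j t j *: (p j).1.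
Proof. by rewrite (big_morph fst (fun _ _ => erefl) erefl). Qed.

Lemma sum_snd (A : finType) (t : A -> R) (p : A -> V') v :
  (\sum_j t j *: p j).2 v = \sum_j t j * (p j).2 v.
Proof.
rewrite (big_morph snd (fun _ _ => erefl) erefl) sum_ffunE.
by apply: eq_bigr => j _; rewrite ffunE.
Qed.

Lemma wedge_inside x : inside wedge_aff wedge_coord x -> inside aff y x.1.
Proof.
move=> [[ax xE] x0]; split=> // i; rewrite -xE.
by apply: sumr_ge0 => v _; exact: x0.
Qed.

(** If no coordinate drops from [x] to [z], no block sum drops, so no slack of the base does and the
    base points agree. Equal block sums then force equal coordinates. *)
Lemma wedge_cell : cell aff y -> cell wedge_aff wedge_coord.
Proof.
move=> hC; split.
- move=> A t p t1 ap; split=> [|i].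
    by rewrite sum_fst; apply: (cell_aff hC) => // j; case: (ap j).
  rewrite sum_fst (cell_map hC)//.
  under eq_bigr do rewrite sum_snd.
  rewrite exchange_big /=; apply: eq_bigr => j _.
  by rewrite -mulr_sumr; have [_ ->] := ap j.
- by move=> v A t p _; rewrite /wedge_coord sum_snd.
move=> x z hx [az zE]; have [[ax xE] x0] := hx.
apply: contra_neqP => hn.
have xz v : x.2 v <= z.2 v by rewrite leNgt; apply/negP => h; apply: hn; exists v.
have x1 : x.1 = z.1.
  apply/eqP/negPn/negP => /(cell_ray hC (wedge_inside hx) az)[j].
  by rewrite -xE -zE ltNge ler_sum.
have x2 : x.2 = z.2.
  apply/ffunP => v; apply/eqP; rewrite eq_sym -subr_eq0.
  have : \sum_(u | blk u == blk v) (z.2 u - x.2 u) == 0.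
    by rewrite sumrB xE zE x1 subrr.
  rewrite psumr_eq0 => [/allP/(_ v (mem_index_enum _))|u _]; last by rewrite subr_ge0.
  by rewrite eqxx.
by case: x z x1 x2 {hx az zE ax xE x0 hn xz} => [? ?] [? ?] /= -> ->.
Qed.

(** Over the center of the full blocks of [u], each slack is shared equally among the coordinates of
    its block outside [u]; then exactly the coordinates in [u] vanish. *)
Lemma wedge_centers : cell aff y -> centers aff y K b -> K finset.set0 ->
  (forall i, exists v, blk v = i) ->
  exists b', centers wedge_aff wedge_coord [set u | K (full_blocks blk u)] b'.
Proof.
move=> hC hb K0 blkS; pose B := full_blocks blk.
pose free (u : {set T}) i := #|[pred v | (blk v == i) && (v \notin u)]|.
pose c (u : {set T}) : V' := (b (B u),
  [ffun v => (if v \in u then 0 else y (blk v) (b (B u)) / (free u (blk v))%:R) : R^o]).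
have cP u : K (B u) -> inside wedge_aff wedge_coord (c u) /\ zeros wedge_coord (c u) = u.
  move=> Ku; have [ab b0] := center_inside hb (B u); have bz := center_zeros hb Ku.
  split.
    split=> [|v]; last first.
      by rewrite /wedge_coord ffunE; case: ifP => // _; rewrite divr_ge0// b0.
    split=> //= i; under eq_bigr do rewrite ffunE.
    rewrite (eq_bigr (fun v => if v \notin u then y i (b (B u)) / (free u i)%:R else 0));
        last first.
      by move=> v /eqP ->; rewrite if_neg.
    rewrite -big_mkcondr sumr_const -/(free u i) -[_ *+ _]mulr_natr.
    (* A block without free coordinates is full, so its slack is zero at the center and nothing has
       to be distributed. *)
    have [fi|fi] := eqVneq (free u i) 0%N; last by rewrite divfK// pnatr_eq0.
    have : i \in zeros y (b (B u)).
      rewrite bz; apply/full_blocksP => v vi; apply: contraTT isT => vu.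
      by have := card0_eq fi v; rewrite !inE vi eqxx vu.
    by rewrite inE => /eqP ->; rewrite !mul0r.
  apply/setP => v; rewrite inE /wedge_coord ffunE; case: ifPn => vu; first by rewrite eqxx.
  apply/negP; rewrite mulf_eq0 invr_eq0 pnatr_eq0 => /orP[yb|].
    have : blk v \in zeros y (b (B u)) by rewrite inE.
    by rewrite bz => /full_blocksP/(_ v erefl); exact/negP.
  by move=> /eqP/card0_eq/(_ v); rewrite !inE eqxx vu.
(* Blocks are nonempty, so the empty simplex has no full block; its center is the default value
   outside the complex. *)
have B0 : B finset.set0 = finset.set0.
  apply/setP => i; rewrite [RHS]inE; apply/full_blocksP => h.
  by have [v /h] := blkS i; rewrite inE.
exists (fun u => if `[< K (B u) >] then c u else c finset.set0); split.
- move=> u; case: asboolP => [/cP[]//|_]; apply: (cP _ _).1.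
  by rewrite B0.
- by move=> u Ku; case: asboolP => [/cP[]//|].
move=> x hx; rewrite /mkset; have h0 := hx.2; have [[_ xE] _] := hx.
suff -> : full_blocks blk (zeros wedge_coord x) = zeros y x.1.
  exact/(zeros_complex hb)/wedge_inside.
apply/setP => i; rewrite [RHS]inE -xE psumr_eq0 => [|v _]; last exact: h0.
apply/full_blocksP/allP => [h v _|h v /eqP vi].
  by apply/implyP => /eqP/h; rewrite inE.
by have := h v (mem_index_enum _); rewrite vi inE.
Qed.

End Wedge.

(** * Quotient mappings *)

Section Continuity.

Lemma continuous_prod_topology (X : topologicalType) (I : Type)
    (K : I -> topologicalType) (f : X -> prod_topology K) :
  (forall i, continuous (fun x => f x i)) -> continuous f.
Proof.
move=> h x; apply/cvg_sup => i U [? /= [[W oW <-]]] /= Wfx /filterS; apply.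
by apply: h; exact: open_nbhs_nbhs.
Qed.

Lemma continuous_set_type (X Y : topologicalType) (A : set Y) (f : X -> A) :
  continuous (\val \o f) -> continuous f.
Proof. exact: continuous_comp_initial. Qed.

Lemma val_continuous (X : topologicalType) (A : set X) :
  continuous (\val : A -> X).
Proof. exact: initial_continuous. Qed.

Lemma continuous_rV (X T : topologicalType) (j : nat) (f : X -> 'rV[T]_j) :
  (forall i, continuous (fun x => f x 0 i)) -> continuous f.
Proof.
move=> h x A [B hB BA].
have : \forall z \near x, forall i, B 0 i (f z 0 i).
  by apply: filter_forall => i; exact: h (hB 0 i).
by apply: (@filterS _ (nbhs x)) => z hz; apply: BA => a b; rewrite ord1.
Qed.

Lemma continuous_pair (X Y Z : topologicalType) (f : X -> Y) (g : X -> Z) :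
  continuous f -> continuous g -> continuous (fun x => (f x, g x)).
Proof. by move=> cf cg x; apply: cvg_pair; [exact: cf|exact: cg]. Qed.

End Continuity.

(** * Hausdorff and compact subspaces and products *)

Section Separation.

Lemma cluster_map (X Y : topologicalType) (f : X -> Y) p q :
  hausdorff_space Y -> continuous f -> cluster (nbhs p) q -> f p = f q.
Proof.
move=> hY cf cl; apply: hY => A B pA qB.
have [z [Az Bz]] := cl _ _ (cf _ _ pA) (cf _ _ qB).
by exists (f z).
Qed.

Lemma hausdorff_set_type (X : topologicalType) (A : set X) :
  hausdorff_space X -> hausdorff_space A.
Proof.
move=> hX p q cl; apply: val_inj.
exact: (cluster_map hX (@val_continuous _ A) cl).
Qed.

Lemma hausdorff_prod (X Y : topologicalType) :
  hausdorff_space X -> hausdorff_space Y -> hausdorff_space (X * Y)%type.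
Proof.
move=> hX hY [p1 p2] [q1 q2] cl; congr (_, _).
  exact: (cluster_map hX (fun _ => cvg_fst) cl).
exact: (cluster_map hY (fun _ => cvg_snd) cl).
Qed.

Lemma hausdorff_prod_topology (I : eqType) (K : I -> topologicalType) :
  (forall i, hausdorff_space (K i)) -> hausdorff_space (prod_topology K).
Proof. exact: hausdorff_product. Qed.

Lemma compact_set_type (X : topologicalType) (A : set X) :
  compact A -> compact [set: A].
Proof.
move=> cA F FF _; have FA : (\val @ F) A.
  by apply: (@filterS _ F _ setT) => [x _ /=|]; [exact: set_valP|exact: filterT].
have [p [Ap cl]] := cA (\val @ F) (fmap_proper_filter _ _) FA.
exists (SigSub (mem_set Ap)); split=> // U V FU [W [[W' oW' <-] /= pW'] WV].
have FU' : (\val @ F) (\val @` U).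
  by apply: (@filterS _ F _ U) => // x Ux; exists x.
have [_ [[u Uu <-] W'u]] := cl _ _ FU' (open_nbhs_nbhs (conj oW' pW')).
by exists u; split=> //; exact: WV.
Qed.

End Separation.

Section QuotientMappings.

Definition quotient_mapping (X Y : topologicalType) (p : X -> Y) : Prop :=
  [/\ continuous p, forall y, exists x, p x = y
    & forall U, open (p @^-1` U) -> open U].

Lemma quotient_mapping_comp (X Y Z : topologicalType) (p : X -> Y) (q : Y -> Z) :
  quotient_mapping p -> quotient_mapping q -> quotient_mapping (q \o p).
Proof.
move=> [cp sp op] [cq sq oq]; split.
- by move=> x; apply: continuous_comp; [exact: cp|exact: cq].
- by move=> z; have [y <-] := sq z; have [x <-] := sp y; exists x.
- by move=> U /op/oq.
Qed.

(** Closed subsets of the source are compact, and so are their images, which are then closed: [p] is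
    a closed map. *)
Lemma compact_quotient_mapping (X Y : topologicalType) (p : X -> Y) :
  compact [set: X] -> hausdorff_space Y -> continuous p ->
  (forall y, exists x, p x = y) -> quotient_mapping p.
Proof.
move=> cX hY cp sp; split=> // U oU.
rewrite -[U]setCK openC; have -> : ~` U = p @` (p @^-1` ~` U).
  apply/seteqP; split=> [y Uy|_ [x Ux <-]//]; have [x xy] := sp y.
  by exists x; rewrite /= ?xy.
apply: compact_closed => //; apply: continuous_compact.
  exact: continuous_subspaceT.
by apply: subclosed_compact cX _ => //; rewrite preimage_setC closedC.
Qed.

Lemma quotient_map_mapping (T : topologicalType) (r : T -> T -> Prop)
    (r_equiv : Equivalence r) : quotient_mapping (quotient_map r_equiv).
Proof.
split; first exact: pi_continuous.
- by move=> y; exists (repr y); exact: reprK.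
- by [].
Qed.

Definition open_mapping (X Y : topologicalType) (p : X -> Y) : Prop :=
  forall x U, nbhs x U -> nbhs (p x) (p @` U).

Lemma open_quotient_mapping (X Y : topologicalType) (p : X -> Y) :
  continuous p -> open_mapping p -> (forall y, exists x, p x = y) ->
  quotient_mapping p.
Proof.
move=> cp op sp; split=> // U; rewrite !openE => oU y Uy.
have [x xy] := sp y; have := oU x; rewrite /= xy => /(_ Uy) /op; rewrite xy.
by apply: filterS => _ [z Uz <-].
Qed.

(** Openness passes to the product with an identity, whereas being a quotient mapping in general
    does not. The orbit map is multiplied by [P] in this way. *)
Lemma open_mapping_id (X Y Z : topologicalType) (p : X -> Y) :
  open_mapping p -> open_mapping (fun x : X * Z => (p x.1, x.2)).
Proof.
move=> op [x z] U [[A B] /= [xA zB] AB].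
exists (p @` A, B) => /=; first by split=> //; exact: op.
by move=> [_ b] /= [[a Aa <-] Bb]; exists (a, b) => //; exact: AB.
Qed.

(** The sections [f] and [g] come from choice and need not be continuous; [q \o f] is continuous
    because its composite with the quotient mapping [p] is [q]. *)
Lemma quotient_mapping_homeo (X Y Z : topologicalType) (p : X -> Y) (q : X -> Z) :
  quotient_mapping p -> quotient_mapping q ->
  (forall x x', p x = p x' <-> q x = q x') -> homeomorphic Y Z.
Proof.
move=> [cp sp op] [cq sq oq] pq.
have [f fP] := choice sp; have [g gP] := choice sq.
have fq x : q (f (p x)) = q x by apply/pq; rewrite fP.
have gp x : p (g (q x)) = p x by apply/pq; rewrite gP.
exists (q \o f), (p \o g); split.
- apply/continuousP => U oU; apply: op.
  rewrite (_ : _ @^-1` _ = q @^-1` U); first by move/continuousP: cq; apply.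
  by apply/seteqP; split=> x; rewrite /= fq.
- apply/continuousP => U oU; apply: oq.
  rewrite (_ : _ @^-1` _ = p @^-1` U); first by move/continuousP: cp; apply.
  by apply/seteqP; split=> x; rewrite /= gp.
- by move=> y /=; rewrite gp fP.
- by move=> z /=; rewrite fq gP.
Qed.

End QuotientMappings.

(** * The circle *)

Section Circle.
Context {R : realType}.
Local Notation C := (R[i]).

Definition cis (t : R) : C := (cos t +i* sin t)%C.

Lemma real_complex_continuous : continuous (fun x : R => (x%:C)%C : Cplx R).
Proof.
move=> x A /nbhs_ballP[e /= e0 eA]; apply/nbhs_ballP.
have e0' := e0; rewrite ltcE in e0'; case/andP: e0' => /eqP ei er.
exists (complex.Re e) => //= z; rewrite /ball /= => xz; apply: eA; rewrite /ball /=.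
rewrite -rmorphB /= normc_def /= expr0n addr0 sqrtr_sqr ltcE /= ei xz eqxx//.
Qed.

Lemma complex_continuous (X : topologicalType) (u v : X -> R) :
  continuous u -> continuous v ->
  continuous (fun x => (u x +i* v x)%C : Cplx R).
Proof.
move=> cu cv x.
have -> : (fun x => (u x +i* v x)%C : Cplx R) =
    (fun x => (u x)%:C%C + ('i%C : Cplx R) * (v x)%:C%C).
  by apply/funext => z; rewrite [LHS]complexE.
apply: cvgD; first exact: (continuous_comp (cu x) (@real_complex_continuous _)).
apply: cvgM; first exact: cvg_cst.
exact: (continuous_comp (cv x) (@real_complex_continuous _)).
Qed.

Lemma cis_continuous : continuous (cis : R -> Cplx R).
Proof. by apply: complex_continuous; [exact: continuous_cos|exact: continuous_sin]. Qed.

Lemma cisD x y : cis (x + y) = cis x * cis y.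
Proof. exact: (@torus_expD R 1 (fun=> x) (fun=> y) 0). Qed.

Lemma cis0 : cis 0 = 1.
Proof. by rewrite /cis cos0 sin0. Qed.

Lemma cisN x : cis (- x) = (cis x)^-1.
Proof. exact: (@torus_expN R 1 (fun=> x) 0). Qed.

Lemma norm_cis x : `|cis x| = 1.
Proof. by rewrite normc_def /= cos2Dsin2 sqrtr1. Qed.

Lemma cis_neq0 x : cis x != 0.
Proof. by rewrite -normr_eq0 norm_cis oner_eq0. Qed.

Lemma cis_sum (T : finType) (x : T -> R) : cis (\sum_i x i) = \prod_i cis (x i).
Proof. exact: (big_morph cis cisD cis0). Qed.

Lemma cis_int x (k : int) : cis (x * k%:~R) = cis x ^ k.
Proof.
have nat n : cis (x * n%:R) = cis x ^+ n.
  by elim: n => [|n IH]; rewrite ?mulr0 ?cis0// -natr1 mulrDr mulr1 cisD IH exprSr.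
case: k => n; first exact: nat.
by rewrite NegzE rmorphN /= mulrN cisN nat -exprnN.
Qed.

Lemma cis_lin (T : finType) (x : T -> R) (k : T -> int) :
  cis (\sum_i x i * (k i)%:~R) = \prod_i cis (x i) ^ k i.
Proof. by rewrite cis_sum; apply: eq_bigr => i _; rewrite cis_int. Qed.

Lemma cis_surj (z : C) : `|z| = 1 -> exists2 t, t \in `[- pi, pi] & cis t = z.
Proof.
case: z => a b; rewrite normc_def /= => -[/(congr1 (fun x => x ^+ 2))].
rewrite expr1n sqr_sqrtr ?addr_ge0 ?sqr_ge0// => ab.
have a1 : -1 <= a <= 1 by apply/andP; split; nra.
have ca : cos (acos a) = a by rewrite acosK// in_itv.
have p0 := acos_ge0 a1; have p1 := acos_lepi a1; have pi0 : 0 <= pi :> R := pi_ge0 _.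
have sa : sin (acos a) = `|b|.
  by rewrite sin_acos// -sqrtr_sqr; congr Num.sqrt; rewrite -ab addrAC subrr add0r.
have [b0|b0] := leP 0 b.
  exists (acos a); last by rewrite /cis ca sa ger0_norm.
  by rewrite in_itv /= p1 (le_trans _ p0)// oppr_le0.
exists (- acos a); last by rewrite /cis cosN sinN ca sa ltr0_norm// opprK.
by rewrite in_itv /= lerN2 p1 (le_trans _ pi0)// oppr_le0.
Qed.

Lemma polar (z : C) : exists2 t, t \in `[- pi, pi] & z = (complex.Re `|z|)%:C%C * cis t.
Proof.
have nE : (complex.Re `|z|)%:C%C = `|z| by rewrite RRe_real// normr_real.
have [->|z0] := eqVneq z 0.
  exists 0; last by rewrite normr0 mul0r.
  by rewrite in_itv /= oppr_le0 pi_ge0.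
have [|t tpi tz] := @cis_surj (z / `|z|).
  by rewrite normrM normfV normr_id divff// normr_eq0.
by exists t => //; rewrite tz nE mulrC divfK// normr_eq0.
Qed.

End Circle.

(** * The matrix lambda(J) *)

Section Blocks.
Context {m : nat} (J : 'I_m -> nat).
Hypothesis J0 : forall i, (0 < J i)%N.

Lemma vertex_block_lshift k : vertex_block J (lshift m k) = tagnat.sig1 k.
Proof. by rewrite /vertex_block (unsplitK (inl k)). Qed.

Lemma vertex_block_rshift i : vertex_block J (rshift (extra J) i) = i.
Proof. by rewrite /vertex_block (unsplitK (inr i)). Qed.

Lemma card_block i : #|[pred v | vertex_block J v == i]| = J i.
Proof.
rewrite -sum1_card big_split_ord /=.
under eq_bigl do rewrite inE vertex_block_lshift.
under [X in (_ + X)%N]eq_bigl do rewrite inE vertex_block_rshift.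
rewrite big_pred1_eq (reindex _ (onW_bij _ (@tagnat.rank_bij _ _))) /=.
rewrite (eq_bigl (fun p : {i & 'I_(J i).-1} => (tag p == i) && true)); last first.
  by move=> p; rewrite /= /tagnat.sig1 tagnat.rankK andbT.
rewrite -(@sig_big_dep _ _ _ _ (fun i' => 'I_(J i').-1 : finType) (fun i' => i' == i)
  (fun _ _ => true) (fun _ _ => 1%N)).
by rewrite big_pred1_eq sum1_card card_ord addn1 prednK.
Qed.

(** How the vertices of a block are matched with the coordinates of C^(j_i) is immaterial: the
    circle multiplies all of them by the same scalar. *)
Definition block_vertex i (s : 'I_(J i)) : 'I_(extra J + m) :=
  enum_val (cast_ord (esym (card_block i)) s).

Lemma block_vertexK i s : vertex_block J (@block_vertex i s) = i.
Proof. by have /= := enum_valP (cast_ord (esym (card_block i)) s); rewrite inE => /eqP. Qed.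

Lemma block_vertex_surj v : exists s, @block_vertex (vertex_block J v) s = v.
Proof.
have vP : v \in [pred u | vertex_block J u == vertex_block J v] by rewrite inE.
exists (cast_ord (card_block _) (enum_rank_in vP v)).
by rewrite /block_vertex cast_ordK enum_rankK_in.
Qed.

Lemma block_vertex_inj i : injective (@block_vertex i).
Proof. by move=> s s' /enum_val_inj /cast_ord_inj. Qed.

Lemma sum_block_vertex (M : nmodType) (f : 'I_(extra J + m) -> M) i :
  \sum_(s < J i) f (block_vertex s) = \sum_(v | vertex_block J v == i) f v.
Proof.
rewrite (reindex (@block_vertex i)) /=; last first.
  have f0 v : vertex_block J v == i -> exists s, @block_vertex i s = v.
    by move/eqP => <-; exact: block_vertex_surj.
  have [s0|s0] := pselect (inhabited 'I_(J i)); last first.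
    by exfalso; apply: s0; split; exact: Ordinal (J0 i).
  exists (fun v => odflt (Ordinal (J0 i)) [pick s | @block_vertex i s == v]).
    move=> s _; case: pickP => [s' /eqP/block_vertex_inj//|/(_ s)].
    by rewrite eqxx.
  move=> v /f0[s sv]; case: pickP => [s' /eqP//|/(_ s)].
  by rewrite sv eqxx.
by apply: eq_bigl => s; rewrite block_vertexK eqxx.
Qed.

End Blocks.

(** * The homomorphisms of tori given by lambda and lambda(J) *)

Section Characters.
Context {R : realType} {n m : nat} (J : 'I_m -> nat) (lambda : 'M[int]_(n, m)).
Implicit Types theta : 'I_(extra J + m) -> R.

(* [mx_angle mu t] is the image of [t] under the map of Lie algebras
   induced by [mu]. *)
Definition mx_angle (q r : nat) (mu : 'M[int]_(q, r)) (t : 'I_r -> R) (a : 'I_q) : R :=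
  \sum_i t i * (mu a i)%:~R.

Lemma mx_angle_lambdaJl theta k : mx_angle (lambdaJ J lambda) theta (lshift n k) =
  theta (lshift m k) - theta (rshift (extra J) (tagnat.sig1 k)).
Proof.
rewrite /mx_angle /lambdaJ big_split_ord /=.
under eq_bigr do rewrite block_mxEul mxE.
under [X in _ + X]eq_bigr do rewrite block_mxEur !mxE.
rewrite (bigD1 k)//= eqxx mulr1 big1 => [|i ik]; last by rewrite eq_sym (negPf ik) mulr0.
rewrite addr0 (bigD1 (tagnat.sig1 k))//= eqxx mulrN mulr1 big1 ?addr0// => i ik.
by rewrite eq_sym (negPf ik) oppr0 mulr0.
Qed.

Lemma mx_angle_lambdaJr theta a : mx_angle (lambdaJ J lambda) theta (rshift (extra J) a) =
  mx_angle lambda (fun i => theta (rshift (extra J) i)) a.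
Proof.
rewrite /mx_angle /lambdaJ big_split_ord /= big1 ?add0r => [|i _].
  by apply: eq_bigr => i _; rewrite block_mxEdr.
by rewrite block_mxEdl mxE mulr0.
Qed.

(** Columns of rank [n] over [rat] have a rational right inverse, which [ratr] carries to the reals;
    coordinates outside [s] are set to zero. *)
Lemma mx_angle_onto (s : {set 'I_m}) : col_rank lambda s = n ->
  forall g : 'I_n -> R, exists t, mx_angle lambda t = g.
Proof.
move=> rk g; pose A := colsub (@enum_val _ (mem s)) lambda.
pose AQ : 'M[rat]_(n, #|s|) := map_mx intr A.
have AD : AQ *m pinvmx AQ = 1%:M by apply: mulmxVp; rewrite /row_free -[X in _ == X]rk.
have [v Av] : exists v : 'cV[R]_#|s|, map_mx intr A *m v = \col_a g a.
  exists (map_mx ratr (pinvmx AQ) *m (\col_a g a)).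
  rewrite mulmxA (_ : map_mx intr A = map_mx ratr AQ); last first.
    by rewrite -map_mx_comp; apply: eq_map_mx => z /=; rewrite ratr_int.
  by rewrite -map_mxM AD map_mx1 mul1mx.
exists (fun i => \sum_(j | enum_val j == i) v j 0); apply/funext => a.
have := congr1 (fun M : 'cV_n => M a 0) Av; rewrite [RHS]mxE => <-.
rewrite [RHS]mxE /mx_angle; under eq_bigr do rewrite mulr_suml.
rewrite (exchange_big_dep predT)//=; apply: eq_bigr => j _.
rewrite (big_pred1 (enum_val j)) => [|i]; last by rewrite eq_sym.
by rewrite mulrC; congr (_ * _); rewrite !mxE.
Qed.

Lemma mx_angle_lambdaJ_onto (s : {set 'I_m}) : col_rank lambda s = n ->
  forall g : 'I_(extra J + n) -> R, exists theta, mx_angle (lambdaJ J lambda) theta = g.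
Proof.
move=> rk g; have [t0 t0g] := mx_angle_onto rk (fun k => g (rshift (extra J) k)).
(* The system is block triangular: [lambda] gives the angles of the v_i1, and the upper rows then
   give those of the other v_is. *)
exists (fun v => match fintype.split v with
  | inl k => g (lshift n k) + t0 (tagnat.sig1 k) | inr i => t0 i end).
apply/funext => a; rewrite -(splitK a); case: (fintype.split a) => k /=.
  by rewrite mx_angle_lambdaJl (unsplitK (inl k)) (unsplitK (inr _)) addrK.
rewrite mx_angle_lambdaJr -[RHS]/((fun k => g (rshift (extra J) k)) k) -t0g; congr (mx_angle _ _ _).
by apply/funext => i /=; rewrite (unsplitK (inr i)).
Qed.

(** The upper rows force the angles within a block to agree modulo 2 pi, and the lower rows put the
    common values into the kernel of [lambda]. *)
Lemma cis_lambdaJ_eq1 theta :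
  (forall a, cis (mx_angle (lambdaJ J lambda) theta a) = 1) <->
  exists2 t : torus m, torus_kernel lambda t &
    forall v, cis (theta v) = \val (t (vertex_block J v)).
Proof.
split=> [h|[t tk tE] a].
  exists (torus_of (fun i => norm_cis (theta (rshift (extra J) i)))) => [a|v].
    have := h (rshift (extra J) a); rewrite mx_angle_lambdaJr /mx_angle cis_lin => e.
    by rewrite -[RHS]e; apply: eq_bigr => i _; rewrite torus_ofE.
  rewrite torus_ofE -(splitK v); case: (fintype.split v) => k /=.
    have := h (lshift n k); rewrite mx_angle_lambdaJl cisD cisN => /divr1_eq ->.
    by rewrite vertex_block_lshift.
  by rewrite vertex_block_rshift.
rewrite -(splitK a); case: (fintype.split a) => k /=.
  rewrite mx_angle_lambdaJl cisD cisN !tE vertex_block_lshift vertex_block_rshift divff//.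
  by rewrite -normr_eq0 (set_valP (t _)) oner_eq0.
rewrite mx_angle_lambdaJr /mx_angle cis_lin -[RHS](tk k).
by apply: eq_bigr => i _; rewrite /= tE vertex_block_rshift.
Qed.

End Characters.

(** * Orbit spaces of products of spheres *)

Section OrbitSpace.
Context {R : realType} {n m : nat} (J : 'I_m -> nat) (lambda : 'M[int]_(n, m)).
Local Notation X := (@spheres R m J 'I_m id).
Local Notation om := (@orbit_map R n m J lambda 'I_m id).

Lemma sphere_coord_continuous j (k : 'I_j) :
  continuous (fun z : @sphere R j => \val z 0 k : Cplx R).
Proof.
move=> z; exact: (continuous_comp (@val_continuous _ _ z) (@coord_continuous _ _ _ 0 k _)).
Qed.

Lemma circle_scale_sphere j (t : @circle R) (x : @sphere R j) :
  (\val t : R[i]) *: \val x \in @sphere R j.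
Proof.
apply/mem_set; rewrite /sphere /=; apply: etrans (set_valP x); apply: eq_bigr => k _.
by rewrite mxE normrM (set_valP t) mul1r.
Qed.

Definition sphere_act (t : torus m) (x : X) : X :=
  fun i => SigSub (circle_scale_sphere (t i) (x i)).

Lemma sphere_act_continuous t : continuous (sphere_act t).
Proof.
apply: continuous_prod_topology => i; apply: continuous_set_type.
apply: continuous_rV => k x; rewrite /=.
have -> : (fun x : X => ((\val (t i) : R[i]) *: \val (x i)) 0 k) =
   (fun x : X => (\val (t i) : Cplx R) * \val (x i) 0 k).
  by apply/funext => z; rewrite mxE.
apply: (@cvgM _ _ (nbhs x)); first exact: (@cvg_cst _ _ _ (nbhs x)).
apply: (@continuous_comp _ _ _ (fun x : X => x i) (fun z : @sphere R (J i) => \val z 0 k)).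
  exact: (@proj_continuous _ (fun i => @sphere R (J i)) i).
exact: sphere_coord_continuous.
Qed.

(** The saturation of an open set is the union of its preimages under the continuous maps
    [sphere_act t], with [t] in the kernel. *)
Lemma orbit_map_open : open_mapping om.
Proof.
move=> x U; rewrite nbhsE => -[V [oV Vx] VU].
have : open (om @` V).
  have [_ _] := quotient_map_mapping (@orbit_rel_equiv R n m J lambda 'I_m id).
  apply; suff -> : om @^-1` (om @` V) =
      \bigcup_(t in torus_kernel lambda) (sphere_act t @^-1` V).
    by apply: bigcup_open => t _; move/continuousP: (sphere_act_continuous (t := t)); apply.
  apply/seteqP; split=> [z [y Vy yz]|z [t tk Vz]].
    have [t tk tE] : orbit_rel lambda z y.
      by apply/(quotient_mapP (orbit_rel_equiv _ _ _)); exact: esym yz.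
    exists t => //=; suff -> : sphere_act t z = y by [].
    by apply: functional_extensionality_dep => i; apply/val_inj; rewrite /= -tE.
  exists (sphere_act t z) => //; apply/esym/(quotient_mapP (orbit_rel_equiv _ _ _)).
  by exists t.
move=> oW; apply: (@filterS _ _ _ (om @` V)); first exact: image_subset.
by apply: open_nbhs_nbhs; split=> //; exists x.
Qed.

Lemma orbit_map_quotient (Y : topologicalType) :
  quotient_mapping (fun x : X * Y => (om x.1, x.2)).
Proof.
have [c s _] := quotient_map_mapping (@orbit_rel_equiv R n m J lambda 'I_m id).
apply: open_quotient_mapping.
- apply: continuous_pair; last by move=> x; exact: cvg_snd.
  move=> x; apply: (@continuous_comp _ _ _ fst om); first exact: cvg_fst.
  exact: c.
- exact/open_mapping_id/orbit_map_open.
- by move=> [z y]; have [x xz] := s z; exists (x, y); rewrite /= /orbit_map xz.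
Qed.

Lemma hausdorff_spheres : hausdorff_space X.
Proof.
apply: hausdorff_prod_topology => i; apply: hausdorff_set_type; exact: norm_hausdorff.
Qed.

Lemma hausdorff_torus k : hausdorff_space (@torus R k).
Proof.
apply: hausdorff_prod_topology => i; apply: hausdorff_set_type; exact: norm_hausdorff.
Qed.

End OrbitSpace.

(** * The common parametrization *)

Section RealContinuity.
Context {R : realType} {X : topologicalType}.
Implicit Types f g : X -> R.

Lemma continuous_sum (T : finType) (p : pred T) (f : T -> X -> R) :
  (forall i, continuous (f i)) -> continuous (fun x => \sum_(i | p i) f i x).
Proof. by move=> cf; apply: continuous_big => [|i _]; [exact: add_continuous|]. Qed.

Lemma continuous_mul f g : continuous f -> continuous g -> continuous (fun x => f x * g x).
Proof. by move=> cf cg x; exact: (@cvgM _ _ (nbhs x) _ f g _ _ (cf x) (cg x)). Qed.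

Lemma continuous_mulr f (c : R) : continuous f -> continuous (fun x => f x * c).
Proof. by move=> cf; apply: continuous_mul => // x; exact: (@cvg_cst _ _ _ (nbhs x)). Qed.

Lemma closed_eq_fun f g : continuous f -> continuous g -> closed [set x | f x = g x].
Proof.
move=> cf cg; rewrite (_ : [set x | _] = (fun x => f x - g x) @^-1` [set z | z = 0]).
  apply: closed_comp; last exact: closed_eq.
  by move=> x _; exact: (@cvgB _ _ _ (nbhs x) _ f g _ _ (cf x) (cg x)).
apply/seteqP; split=> x /=; first by move=> ->; rewrite subrr.
by move/eqP; rewrite subr_eq0 => /eqP.
Qed.

Lemma closed_ge_fun f (c : R) : continuous f -> closed [set x | c <= f x].
Proof.
move=> cf; rewrite (_ : [set x | _] = f @^-1` [set z | c <= z])//.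
by apply: closed_comp; [move=> x _; exact: cf|exact: closed_ge].
Qed.

Lemma closed_forall (T : Type) (p : T -> set X) :
  (forall i, closed (p i)) -> closed [set x | forall i, p i x].
Proof.
move=> cp; rewrite (_ : [set x | _] = \bigcap_i p i).
  by apply: closed_bigI => i _; exact: cp.
by apply/seteqP; split=> x /= h i; [move=> _|]; apply: h.
Qed.

Lemma closed_implies (A : Prop) (p : set X) : (A -> closed p) -> closed [set x | A -> p x].
Proof.
move=> cp; have [a|a] := pselect A.
  by rewrite (_ : [set x | _] = p); [exact: cp|apply/seteqP; split=> x //=; exact].
by rewrite (_ : [set x | _] = setT); [exact: closedT|apply/seteqP; split=> x /=].
Qed.

End RealContinuity.

(** * The compact parameter space and its two quotient mappings *)

Section Model.
Context {R : realType} {n m N N' : nat} (J : 'I_m -> nat).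
Local Notation r := (extra J + m)%N.
Local Notation blk := (vertex_block J).
Local Notation V := 'rV[R]_N.
Context (P : set V) (F : 'I_m -> set V) (lambda : 'M[int]_(n, m)).
Context (Q : set 'rV[R]_N') (G : 'I_r -> set 'rV[R]_N').
Context (affP : set V) (yP : 'I_m -> V -> R).
Context (affQ : set 'rV[R]_N') (yQ : 'I_r -> 'rV[R]_N' -> R).
Context (L : set {set 'I_r}) (bQ : {set 'I_r} -> 'rV[R]_N').
Context (b : {set 'I_r} -> V * {ffun 'I_r -> R^o}).
Context (s0 : {set 'I_m}).
Local Notation affW := (wedge_aff blk affP yP).
Local Notation coord := (@wedge_coord R V 'I_r).
Hypotheses (J0 : forall i, (0 < J i)%N) (hP : cell affP yP).
Hypothesis PE : forall x, P x <-> inside affP yP x.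
Hypothesis FE : forall i x, F i x <-> P x /\ yP i x = 0.
Hypotheses (hb : centers affW coord L b).
Hypotheses (hQ : cell affQ yQ) (hbQ : centers affQ yQ L bQ).
Hypothesis QE : forall x, Q x <-> inside affQ yQ x.
Hypothesis GE : forall v x, G v x <-> Q x /\ yQ v x = 0.
Hypothesis carrierE : forall v x, Q x -> carrier_face Q x `<=` G v <-> G v x.
Hypothesis rk : col_rank lambda s0 = n.
Let hW : cell affW coord := wedge_cell blk hP.

Local Notation A := (prod_topology (fun _ : 'I_r => R)).
Local Notation D := (prod_topology (fun _ : {set 'I_r} => R)).

(** The coordinate w_v of the point with flag coordinates [d]. Being linear in an arbitrary [d], it
    is visibly continuous on the whole ambient space. *)
Definition weight (v : 'I_r) (d : {set 'I_r} -> R) : R := \sum_s d s * (b s).2 v.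
Definition block_weight (i : 'I_m) (d : {set 'I_r} -> R) : R :=
  \sum_(v | blk v == i) weight v d.

Lemma barycenter_weight d v : (barycenter b d).2 v = weight v d.
Proof. by rewrite /barycenter sum_snd. Qed.

Lemma barycenter_block_weight d i : flag_simplex L d ->
  yP i (barycenter b d).1 = block_weight i d.
Proof.
move=> /(barycenter_inside hW hb)[[_ <-] _].
by apply: eq_bigr => v _; rewrite barycenter_weight.
Qed.

(* Triples of angles, barycentric coordinates on the flags of [L] and moduli. *)
Definition model : set (A * D * A) :=
  [set x | [/\ forall v, - pi <= x.1.1 v <= pi, flag_simplex L x.1.2,
    forall v, 0 <= x.2 v, forall i, \sum_(v | blk v == i) x.2 v * x.2 v = 1
    & forall v, weight v x.1.2 = block_weight (blk v) x.1.2 * (x.2 v * x.2 v)]].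

Lemma angle_continuous v : continuous (fun x : A * D * A => x.1.1 v).
Proof.
move=> x; apply: (@continuous_comp _ _ _ (fun x : A * D * A => x.1.1) (fun f : A => f v)).
  by apply: (@continuous_comp _ _ _ fst fst); exact: cvg_fst.
exact: (@proj_continuous _ (fun=> R) v).
Qed.

Lemma bary_continuous s : continuous (fun x : A * D * A => x.1.2 s).
Proof.
move=> x; apply: (@continuous_comp _ _ _ (fun x : A * D * A => x.1.2) (fun f : D => f s)).
  by apply: (@continuous_comp _ _ _ fst snd); [exact: cvg_fst|exact: cvg_snd].
exact: (@proj_continuous _ (fun=> R) s).
Qed.

Lemma modulus_continuous v : continuous (fun x : A * D * A => x.2 v).
Proof.
move=> x; apply: (@continuous_comp _ _ _ snd (fun f : A => f v)).
  exact: cvg_snd.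
exact: (@proj_continuous _ (fun=> R) v).
Qed.

Lemma weight_continuous v : continuous (fun x : A * D * A => weight v x.1.2).
Proof. by apply: continuous_sum => s; apply/continuous_mulr/bary_continuous. Qed.

Lemma block_weight_continuous i : continuous (fun x : A * D * A => block_weight i x.1.2).
Proof. by apply: continuous_sum => v; exact: weight_continuous. Qed.

Lemma model_closed : closed model.
Proof.
have cm v : continuous (fun x : A * D * A => x.2 v * x.2 v).
  by apply: continuous_mul; exact: modulus_continuous.
have c0 (c : R) : continuous (fun _ : A * D * A => c).
  by move=> x; exact: (@cvg_cst _ _ _ (nbhs x)).
(* The support conditions are contraposed into equations, which are closed: [d s = 0] for [s]
   outside [L], and [d s * d s' = 0] for incomparable [s] and [s']. *)
have -> : model = [set x : A * D * A | forall v, - pi <= x.1.1 v] `&`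
   [set x : A * D * A | forall v, - pi <= x.1.1 v * -1] `&`
   [set x : A * D * A | forall s, 0 <= x.1.2 s] `&` [set x : A * D * A | \sum_s x.1.2 s = 1] `&`
   [set x : A * D * A | forall s, ~ L s -> x.1.2 s = 0] `&`
   [set x : A * D * A | forall s s' : {set 'I_r},
      ~~ ((s \subset s') || (s' \subset s)) -> x.1.2 s * x.1.2 s' = 0] `&`
   [set x : A * D * A | forall v, 0 <= x.2 v] `&`
   [set x : A * D * A | forall i, \sum_(v | blk v == i) x.2 v * x.2 v = 1] `&`
   [set x : A * D * A | forall v, weight v x.1.2 = block_weight (blk v) x.1.2 * (x.2 v * x.2 v)].
  apply/seteqP; split=> x /=.
    move=> [hth [d0 d1 dL dc] a0 a1 wE]; do ![split=> //] => [v|v|s nL|s s' ss].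
    - by case/andP: (hth v).
    - by rewrite mulrN1 lerN2; case/andP: (hth v).
    - by apply: contra_notP nL => /eqP /dL.
    - apply/eqP; rewrite mulf_eq0; apply: contraNT ss; rewrite negb_or.
      by case/andP; exact: dc.
  move=> [[[[[[[[h1 h2] d0] d1] dL] dc] a0] a1] wE]; split=> //.
    move=> v; apply/andP; split; first exact: h1.
    by have := h2 v; rewrite mulrN1 lerN2.
  split=> // [s|s s' ds ds'].
    by apply: contra_neqP => /dL.
  apply: contraNT ds => /dc /eqP; by rewrite mulf_eq0 (negPf ds') orbF.
do 8?[apply: closedI].
- by apply: closed_forall => v; apply: closed_ge_fun; exact: angle_continuous.
- apply: closed_forall => v; apply: closed_ge_fun; apply: continuous_mulr.
  exact: angle_continuous.
- by apply: closed_forall => s; apply: closed_ge_fun; exact: bary_continuous.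
- by apply: closed_eq_fun => //; apply: continuous_sum => s; exact: bary_continuous.
- apply: closed_forall => s; apply: closed_implies => _.
  by apply: closed_eq_fun => //; exact: bary_continuous.
- apply: closed_forall => s; apply: closed_forall => s'; apply: closed_implies => _.
  by apply: closed_eq_fun => //; apply: continuous_mul; exact: bary_continuous.
- by apply: closed_forall => v; apply: closed_ge_fun; exact: modulus_continuous.
- by apply: closed_forall => i; apply: closed_eq_fun => //; exact: continuous_sum.
- apply: closed_forall => v; apply: closed_eq_fun; first exact: weight_continuous.
  exact: continuous_mul (@block_weight_continuous _) (cm _).
Qed.

Lemma model_compact : compact [set: model].
Proof.
apply: compact_set_type; apply: (subclosed_compact model_closed (B :=
  ([set f : A | forall v, `[- pi, pi]%classic (f v)] `*`
   [set f : D | forall s, `[0, 1]%classic (f s)]) `*`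
   [set f : A | forall v, `[0, 1]%classic (f v)])).
  have box (T : eqType) (u v : R) : @compact (prod_topology (fun _ : T => R))
      [set f | forall i, `[u, v]%classic (f i)].
    by apply: (@tychonoff _ (fun=> R) (fun=> `[u, v]%classic)) => i; exact: segment_compact.
  by apply: compact_setX; [apply: compact_setX|]; exact: box.
move=> x [hth [d0 d1 _ _] a0 a1 _]; split=> [|v /=]; first split=> [v|s] /=.
- by rewrite in_itv /= hth.
- rewrite in_itv /= d0 -d1 (bigD1 s)//= lerDl sumr_ge0// => s' _; exact: d0.
- rewrite in_itv /= a0/=; have : x.2 v * x.2 v <= 1.
    rewrite -(a1 (blk v)) (bigD1 v)//= lerDl sumr_ge0// => u _.
    by rewrite mulr_ge0.
  have := a0 v; nra.
Qed.

Lemma model_flag (x : model) : flag_simplex L (\val x).1.2.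
Proof. by have [] := set_valP x. Qed.

Lemma model_Q (x : model) : Q (barycenter bQ (\val x).1.2).
Proof. exact/QE/(barycenter_inside hQ hbQ)/model_flag. Qed.

Lemma model_P (x : model) : P (barycenter b (\val x).1.2).1.
Proof. apply/PE/wedge_inside/(barycenter_inside hW hb)/model_flag. Qed.

Definition sphere_row (a theta : 'I_r -> R) i : 'rV[Cplx R]_(J i) :=
  \row_s ((a (block_vertex J0 s))%:C%C * cis (theta (block_vertex J0 s))).

Lemma norm_real_cis (a t : R) : 0 <= a -> `|a%:C%C * cis t| = a%:C%C.
Proof. by move=> a0; rewrite normrM norm_cis mulr1 ger0_norm// ler0c. Qed.

Lemma sphere_rowP (a theta : 'I_r -> R) i : (forall v, 0 <= a v) ->
  \sum_(v | blk v == i) a v * a v = 1 -> @sphere R (J i) (sphere_row a theta i).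
Proof.
move=> a0 a1; rewrite /sphere /=.
under eq_bigr do rewrite mxE norm_real_cis// expr2 -rmorphM.
by rewrite -rmorph_sum /= (sum_block_vertex J0 (fun v => a v * a v)) a1.
Qed.

Lemma model_sphere (x : model) i : @sphere R (J i) (sphere_row (\val x).2 (\val x).1.1 i).
Proof. by have [_ _ a0 a1 _] := set_valP x; apply: sphere_rowP. Qed.

Definition toric_point (x : model) : @torus R (extra J + n) * Q :=
  (torus_of (fun a => norm_cis (mx_angle (lambdaJ J lambda) (\val x).1.1 a)),
   SigSub (mem_set (model_Q x))).

Definition sphere_point (x : model) : @spheres R m J 'I_m id * P :=
  (fun i => SigSub (mem_set (model_sphere x i)), SigSub (mem_set (model_P x))).

Lemma model_continuous (Y : topologicalType) (f : A * D * A -> Y) :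
  continuous f -> continuous (fun x : model => f (\val x)).
Proof. by move=> cf x; exact: (continuous_comp (@val_continuous _ _ x) (cf _)). Qed.

Lemma rV_barycenter_continuous M (c : {set 'I_r} -> 'rV[R]_M) :
  continuous (fun x : model => \sum_s (\val x).1.2 s *: c s).
Proof.
apply: continuous_rV => j.
have -> : (fun x : model => (\sum_s (\val x).1.2 s *: c s) 0 j) =
    fun x : model => \sum_s (\val x).1.2 s * c s 0 j.
  by apply/funext => x; rewrite summxE; apply: eq_bigr => s _; rewrite mxE.
apply: (@model_continuous _ (fun x : A * D * A => \sum_s x.1.2 s * c s 0 j)).
by apply: continuous_sum => s; apply: continuous_mulr; exact: bary_continuous.
Qed.

Lemma toric_point_continuous : continuous toric_point.
Proof.
apply: continuous_pair.
  apply: continuous_prod_topology => a; apply: continuous_set_type.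
  pose angle (x : A * D * A) := mx_angle (lambdaJ J lambda) x.1.1 a.
  apply: (@model_continuous _ (fun x => cis (angle x) : Cplx R)) => x.
  apply: (@continuous_comp _ _ _ angle (cis : R -> Cplx R)).
    by apply: continuous_sum => v; apply: continuous_mulr; exact: angle_continuous.
  exact: cis_continuous.
by apply: continuous_set_type; exact: rV_barycenter_continuous.
Qed.

Lemma sphere_point_continuous : continuous sphere_point.
Proof.
apply: continuous_pair; last first.
  apply: continuous_set_type.
  have -> : \val \o (fun x : model => SigSub (mem_set (model_P x)) : P) =
      fun x : model => \sum_s (\val x).1.2 s *: (b s).1.
    by apply/funext => x /=; rewrite /barycenter sum_fst.
  exact: rV_barycenter_continuous.
apply: continuous_prod_topology => i; apply: continuous_set_type.
apply: continuous_rV => s; set v := block_vertex J0 s.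
pose z (x : A * D * A) : Cplx R :=
  (x.2 v * cos (x.1.1 v) +i* (x.2 v * sin (x.1.1 v)))%C.
pose proj (x : model) : @sphere R (J i) := SigSub (mem_set (model_sphere x i)).
have -> : (fun x : model => (\val \o proj) x 0 s) = fun x : model => z (\val x).
  by apply/funext => x /=; rewrite mxE /cis /z; simpc.
apply: model_continuous.
apply: complex_continuous; apply: continuous_mul.
- exact: modulus_continuous.
- by move=> x; exact: (continuous_comp (@angle_continuous v x) (@continuous_cos _ _)).
- exact: modulus_continuous.
- by move=> x; exact: (continuous_comp (@angle_continuous v x) (@continuous_sin _ _)).
Qed.

Lemma reduce_angle (t : 'I_r -> R) : exists2 t' : 'I_r -> R,
  (forall v, - pi <= t' v <= pi) & (forall v, cis (t' v) = cis (t v)).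
Proof.
have /choice[t' ht] v : exists u, - pi <= u <= pi /\ cis u = cis (t v).
  by have [u] := cis_surj (norm_cis (t v)); rewrite in_itv /= => hu e; exists u.
by exists t' => v; case: (ht v).
Qed.

Lemma set_type_eq (T : Type) (B : set T) (x y : B) : \val x = \val y -> x = y.
Proof. exact: val_inj. Qed.

Lemma toric_point_surj z : exists x, toric_point x = z.
Proof.
case: z => g q; have Qq := set_valP q.
have /choice[tau tauE] a : exists t, cis t = \val (g a).
  by have [t _ te] := cis_surj (set_valP (g a)); exists t.
have [t0 t0E] := mx_angle_lambdaJ_onto rk tau.
have [t tpi tE] := reduce_angle t0.
have [d Dd dq] := barycenter_surj hQ hbQ ((QE _).1 Qq).
have [[wa wE] w0] := barycenter_inside hW hb Dd.
have W0 v : 0 <= weight v d by rewrite -barycenter_weight; exact: w0.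
have Y0 i : 0 <= block_weight i d by exact: sumr_ge0.
have W_Y0 v : block_weight (blk v) d = 0 -> weight v d = 0.
  move=> /eqP; rewrite psumr_eq0// => /allP/(_ v (mem_index_enum _)).
  by rewrite eqxx => /eqP.
(* Where a block weight vanishes, any unit vector of moduli will do; the one concentrated at v_i1 is
   taken. *)
pose a v : R := if block_weight (blk v) d == 0 then (v == rshift (extra J) (blk v))%:R
  else Num.sqrt (weight v d / block_weight (blk v) d).
have aE v : block_weight (blk v) d != 0 ->
    a v * a v = weight v d / block_weight (blk v) d.
  by move=> /negPf Y; rewrite /a Y -expr2 sqr_sqrtr// divr_ge0.
have hx : model (t, d, a).
  split=> //= [v|i|v].
  - by rewrite /a; case: ifP => _; [exact: ler0n|exact: sqrtr_ge0].
  - have [Yi|Yi] := eqVneq (block_weight i d) 0; last first.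
      rewrite (eq_bigr (fun v => weight v d / block_weight i d)) => [|v /eqP vi].
        by rewrite -mulr_suml divff.
      by rewrite aE vi.
    rewrite (bigD1 (rshift (extra J) i)) /=; last by rewrite vertex_block_rshift.
    rewrite big1 => [|v /andP[/eqP vi vn]]; last first.
      by rewrite /a vi Yi eqxx (negPf vn) mulr0.
    by rewrite /a vertex_block_rshift Yi !eqxx mulr1 addr0.
  - have [Yi|Yi] := eqVneq (block_weight (blk v) d) 0; first by rewrite W_Y0// Yi mul0r.
    by rewrite aE// mulrC divfK.
exists (SigSub (mem_set hx)); congr pair; last exact: set_type_eq.
apply: functional_extensionality_dep => k; apply: set_type_eq.
rewrite torus_ofE -tauE -t0E /mx_angle !cis_lin.
by apply: eq_bigr => v _; rewrite tE.
Qed.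

Lemma sphere_point_surj z : exists x, sphere_point x = z.
Proof.
case: z => x p; have Pp := set_valP p; have ip := (PE _).1 Pp.
(* Quantifying over all [i] and [s] with [block_vertex J0 s = v] avoids transporting [s] along an
   equality of block indices later. *)
have /choice[ta taE] v : exists ta : R * R, [/\ - pi <= ta.1 <= pi, 0 <= ta.2 &
    forall i (s : 'I_(J i)), block_vertex J0 s = v ->
    \val (x i) 0 s = ta.2%:C%C * cis ta.1 /\ `|\val (x i) 0 s| = ta.2%:C%C].
  have [s sv] := block_vertex_surj J0 v.
  have [t] := polar (\val (x (blk v)) 0 s); rewrite in_itv /= => tpi te.
  have a0 : 0 <= complex.Re `|\val (x (blk v)) 0 s|.
    by rewrite normc_def /= sqrtr_ge0.
  exists (t, complex.Re `|\val (x (blk v)) 0 s|); split=> //= i s' s'v.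
  have vi : blk v = i by rewrite -s'v block_vertexK.
  case: i / vi s' s'v => s' s'v.
  have -> : s' = s by apply: (@block_vertex_inj _ _ J0 (blk v)); rewrite sv.
  by split=> //; rewrite RRe_real// normr_real.
pose a v := (ta v).2; pose t v := (ta v).1.
have a0 v : 0 <= a v by case: (taE v).
have a1 i : \sum_(v | blk v == i) a v * a v = 1.
  rewrite -(sum_block_vertex J0 (fun v => a v * a v)); apply: (@complexI R).
  rewrite rmorph_sum /=; apply: etrans (set_valP (x i)); apply: eq_bigr => s _.
  have [_ _ /(_ i s erefl)[_ ->]] := taE (block_vertex J0 s).
  by rewrite expr2; exact: (rmorphM (real_complex R) (a _) (a _)).
pose w : {ffun 'I_r -> R^o} := [ffun v => yP (blk v) (\val p) * (a v * a v) : R^o].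
have wY i : \sum_(v | blk v == i) w v = yP i (\val p).
  rewrite (eq_bigr (fun v => yP i (\val p) * (a v * a v))) => [|v /eqP vi].
    by rewrite -mulr_sumr a1 mulr1.
  by rewrite ffunE vi.
have [|d Dd dE] := barycenter_surj hW hb (x := (\val p, w)).
  split; first by split; [exact: ip.1|exact: wY].
  by move=> v; rewrite /wedge_coord ffunE mulr_ge0 ?ip.2// mulr_ge0.
have WE v : weight v d = w v by rewrite -barycenter_weight dE.
have hx : model (t, d, a).
  split=> //= [v|v]; first by case: (taE v).
  by rewrite WE ffunE -barycenter_block_weight// dE.
exists (SigSub (mem_set hx)); congr pair; last by apply: set_type_eq; rewrite /= dE.
apply: functional_extensionality_dep => i; apply: set_type_eq; apply/rowP => s.
rewrite mxE; have [_ _ /(_ i s erefl)[-> _]] := taE (block_vertex J0 s).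
by [].
Qed.

(** Both sides say that [v] lies in every simplex of the support of [d], because [bQ] and [b] are
    centers for the same complex [L]. *)
Lemma model_zeros d v : flag_simplex L d ->
  G v (barycenter bQ d) <-> weight v d = 0.
Proof.
move=> Dd; have qQ : Q (barycenter bQ d) by exact/QE/(barycenter_inside hQ hbQ).
have h1 := barycenter_zeros hQ hbQ v Dd; have h2 := barycenter_zeros hW hb v Dd.
rewrite /wedge_coord !inE in h1 h2; rewrite barycenter_weight in h2.
split=> [/GE[_ /eqP yq]|/eqP w0]; first exact/eqP/h2/h1.
by apply/GE; split=> //; apply/eqP/h1/h2.
Qed.

(** The face torus frees the angles of the facets through the point, which are the [v] of zero
    weight. Corrected there by [c], the differences of angles lie in the kernel of [lambdaJ] and
    come from a single [t]. *)
Lemma toric_rel_model (x x' : model) :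
  toric_rel G (lambdaJ J lambda) (toric_point x) (toric_point x') <->
  (\val x).1.2 = (\val x').1.2 /\
  exists2 t : torus m, torus_kernel lambda t & forall v, weight v (\val x).1.2 != 0 ->
    cis ((\val x').1.1 v) = \val (t (blk v)) * cis ((\val x).1.1 v).
Proof.
set th := (\val x).1.1; set th' := (\val x').1.1; set d := (\val x).1.2.
have Dd : flag_simplex L d := model_flag x.
have lamE (c : 'I_r -> R) a : cis (mx_angle (lambdaJ J lambda) (fun v => th' v - th v - c v) a) =
    (cis (mx_angle (lambdaJ J lambda) th a))^-1 * cis (mx_angle (lambdaJ J lambda) th' a) *
    (cis (mx_angle (lambdaJ J lambda) c a))^-1.
  rewrite [_^-1 * _]mulrC -!cisN -!cisD; congr cis.
  by rewrite /mx_angle -!sumrB; apply: eq_bigr => v _; rewrite !mulrBl.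
have cisB (c : 'I_r -> R) v : cis (th' v - th v - c v) = cis (th' v) / cis (th v) / cis (c v).
  by rewrite !cisD !cisN.
split=> [[/= dd' [c [c0 cE]]]|[dd' [t tk tE]]].
  split; first exact: barycenter_inj hQ hbQ _ _ Dd (model_flag x') dd'.
  have [a|t tk tE] := (cis_lambdaJ_eq1 (J := J) lambda (fun v => th' v - th v - c v)).1.
    rewrite lamE; have /= := congr1 (fun f => f a) cE.
    by rewrite -/th -/th' => ->; rewrite divff// cis_neq0.
  exists t => // v wv; have cv : c v = 0.
    apply: c0 => /carrierE cG; case/negP: wv; apply/eqP/(model_zeros v Dd).
    exact/cG/model_Q.
  by have := tE v; rewrite cisB cv cis0 divr1 => <-; rewrite divfK// cis_neq0.
split; first by rewrite /= -dd'.
have /choice[phi phiE] i : exists u, cis u = \val (t i).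
  by have [u _ e] := cis_surj (set_valP (t i)); exists u.
(* At zero weight, [c] absorbs the whole difference of angles except the angle of [t]. *)
pose c v := if weight v d == 0 then th' v - th v - phi (blk v) else 0.
exists c; split=> [v|].
  rewrite /c; case: eqVneq => // wv nG; exfalso; apply: nG; apply/carrierE; first exact: model_Q.
  exact/(model_zeros v Dd).
apply/funext => a.
have : cis (mx_angle (lambdaJ J lambda) (fun v => th' v - th v - c v) a) = 1.
  apply: (cis_lambdaJ_eq1 _ _).2; exists t => // v; rewrite -phiE /c.
  have [wv|wv] := eqVneq (weight v d) 0; first by congr cis; ring.
  by rewrite subr0 cisD cisN tE// mulfK ?cis_neq0// phiE.
by rewrite lamE => /divr1_eq.
Qed.

Lemma pair_eq (T U : Type) (x y : T * U) : x.1 = y.1 -> x.2 = y.2 -> x = y.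
Proof. by case: x y => [? ?] [? ?] /= -> ->. Qed.

(** The relation sees only blocks with nonzero slack. There norms show that the moduli agree, hence
    so do all weights and, by [barycenter_inj], the flag coordinates; cancelling nonzero moduli
    compares the angles. In the other blocks all weights vanish and no condition remains. *)
Lemma sphere_rel_model (x x' : model) :
  sphere_rel F (@orbit_map R n m J lambda 'I_m id (sphere_point x).1, (sphere_point x).2)
    (@orbit_map R n m J lambda 'I_m id (sphere_point x').1, (sphere_point x').2) <->
  (\val x).1.2 = (\val x').1.2 /\
  exists2 t : torus m, torus_kernel lambda t & forall v, weight v (\val x).1.2 != 0 ->
    cis ((\val x').1.1 v) = \val (t (blk v)) * cis ((\val x).1.1 v).
Proof.
have [_ Dd a0 _ wE] := set_valP x; have [_ Dd' a0' _ wE'] := set_valP x'.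
set th := (\val x).1.1; set th' := (\val x').1.1.
set d := (\val x).1.2 in Dd wE *; set d' := (\val x').1.2 in Dd' wE' *.
set a := (\val x).2 in a0 wE; set a' := (\val x').2 in a0' wE'.
have FY i : F i (barycenter b d).1 <-> block_weight i d = 0.
  rewrite -barycenter_block_weight//; split=> [/FE[]//|yi].
  by apply/FE; split=> //; exact: model_P.
rewrite /sphere_rel /= !orbit_projE; split.
  move=> [pp' /(quotient_mapP (orbit_rel_equiv _ _ _))[t tk tE]].
  have {}pp' : (barycenter b d).1 = (barycenter b d').1 by exact: pp'.
  have YE i : block_weight i d = block_weight i d'.
    rewrite -(barycenter_block_weight i Dd) -(barycenter_block_weight i Dd').
    by congr (yP i _).
  have cE v : block_weight (blk v) d != 0 ->
      (a' v)%:C%C * cis (th' v) = \val (t (blk v)) * ((a v)%:C%C * cis (th v)).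
    move=> Yv; have iP : blk v \in avoiding_facets F (barycenter b d).1.
      by rewrite inE; apply/negP => /asboolP/FY/eqP; exact/negP.
    have [s sv] := block_vertex_surj J0 v.
    have := congr1 (fun z : 'rV[Cplx R]_(J (blk v)) => z 0 s) (tE (Sub (blk v) iP)).
    by rewrite /sphere_proj /= !mxE sv.
  have aE v : block_weight (blk v) d != 0 -> a' v = a v.
    move=> Yv; have tv : `|\val (t (blk v)) : R[i]| = 1 by exact: (set_valP (t (blk v))).
    apply: (@complexI R); rewrite -(norm_real_cis (th' v) (a0' v)) cE// normrM tv mul1r.
    exact: norm_real_cis.
  have WE v : weight v d = weight v d'.
    rewrite wE wE' -YE; have [->|Yv] := eqVneq (block_weight (blk v) d) 0.
      by rewrite !mul0r.
    by rewrite aE.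
  split.
    apply: (barycenter_inj hW hb Dd Dd').
    apply: (pair_eq pp'); apply/ffunP => v.
    exact: etrans (barycenter_weight d v) (etrans (WE v) (esym (barycenter_weight d' v))).
  exists t => // v; rewrite wE mulf_eq0 negb_or => /andP[Yv av].
  have := cE v Yv; rewrite aE// mulrCA; apply: mulfI.
  by apply: contra_neq av => /complexI ->; rewrite mulr0.
move=> [dd' [t tk tE]]; split; first exact: (congr1 (fun e => (barycenter b e).1) dd').
apply/(quotient_mapP (orbit_rel_equiv _ _ _)); exists t => // -[i iP].
apply/rowP => s; rewrite /sphere_proj /= !mxE -/th -/th' -/a -/a'.
set v := block_vertex J0 s; have vi : blk v = i by exact: block_vertexK.
have Yv : block_weight (blk v) d != 0.
  by rewrite vi; apply/eqP => /FY Fi; have := iP; rewrite inE => /asboolP.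
have aE : a' v = a v.
  have := wE v; have := wE' v; rewrite -dd' => -> /(mulfI Yv) /eqP.
  by rewrite -!expr2 eqrXn2// => /eqP.
have [av|av] := eqVneq (a v) 0; first by rewrite aE av !mul0r mulr0.
rewrite tE; first by rewrite aE vi mulrCA.
by rewrite wE mulf_neq0// mulf_neq0.
Qed.

Lemma model_homeomorphic :
  homeomorphic (toric_manifold Q G (lambdaJ J lambda)) (sphere_quotient J lambda P F).
Proof.
have q1 : quotient_mapping toric_point.
  apply: compact_quotient_mapping; [exact: model_compact| |exact: toric_point_continuous
    |exact: toric_point_surj].
  apply: hausdorff_prod; first exact: hausdorff_torus.
  by apply: hausdorff_set_type; exact: norm_hausdorff.
have q2 : quotient_mapping sphere_point.
  apply: compact_quotient_mapping; [exact: model_compact| |exact: sphere_point_continuous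
    |exact: sphere_point_surj].
  apply: hausdorff_prod; first exact: hausdorff_spheres.
  by apply: hausdorff_set_type; exact: norm_hausdorff.
have p1 := quotient_mapping_comp q1 (quotient_map_mapping (toric_rel_equiv Q G (lambdaJ J lambda))).
have p2 := quotient_mapping_comp (quotient_mapping_comp q2 (orbit_map_quotient J lambda P))
  (quotient_map_mapping (sphere_rel_equiv J lambda P F)).
apply: (quotient_mapping_homeo p1 p2) => x x'.
have e1 := quotient_mapP (toric_rel_equiv Q G (lambdaJ J lambda)) (toric_point x) (toric_point x').
have e2 := quotient_mapP (sphere_rel_equiv J lambda P F)
  (@orbit_map R n m J lambda 'I_m id (sphere_point x).1, (sphere_point x).2)
  (@orbit_map R n m J lambda 'I_m id (sphere_point x').1, (sphere_point x').2).
exact: (iff_trans e1 (iff_trans (toric_rel_model x x')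
  (iff_sym (iff_trans e2 (sphere_rel_model x x'))))).
Qed.

End Model.

Theorem theorem5p1 (R : realType) (n m N N' : nat)
    (P : set 'rV[R]_N) (F : 'I_m -> set 'rV[R]_N)
    (lambda : 'M[int]_(n, m)) (J : 'I_m -> nat)
    (Q : set 'rV[R]_N') (G : 'I_(extra J + m) -> set 'rV[R]_N') :
  simple_polytope n P F ->
  characteristic_function P F lambda ->
  (forall i, (0 < J i)%N) ->
  is_PJ n P F Q G ->
  homeomorphic (toric_manifold Q G (lambdaJ J lambda))
               (sphere_quotient J lambda P F).
Proof.
move=> sP chi J0 [sQ KJ].
have [hP [cP [yP0 FE]]] := facet_slacks sP.
have [hQ [cQ [yQ0 GE]]] := facet_slacks sQ.
have [bP hbP] := simple_polytope_centers sP yP0 FE.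
have [bQ hbQ] := simple_polytope_centers sQ yQ0 GE.
have [s0 cs s0n] := simple_polytope_vertex sP yP0 FE.
have rk : col_rank lambda s0 = n by have [-> _] := chi s0 cs.
have [_ dP _ _] := sP; have [_ [_ [p0 Pp0] _]] := aff_dim_dir dP.
have KP : simplicial_complex (dual_complex P F).
  split; first by exists p0; split=> // i; rewrite finset.in_set0.
  move=> s t ts [x [Px hx]]; exists x; split=> // i it; apply: hx.
  exact: (fintype.subsetP ts).
have cellP := simple_polytope_cell sP yP0 FE.
have blkS i : exists v, vertex_block J v = i.
  by exists (rshift (extra J) i); exact: vertex_block_rshift.
have [b hb] := wedge_centers cellP hbP KP.1 blkS.
(* The polytope of pairs over [P] has the same dual complex as [Q]; this alone ties [Q] to [P]. *)
have LE : [set u | dual_complex P F (full_blocks (vertex_block J) u)] = dual_complex Q G.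
  by apply/seteqP; split=> u /(is_KJE KP KJ u).
rewrite LE in hb.
apply: (model_homeomorphic J0 cellP (simple_polytopeE sP yP0 FE) FE hb
  (simple_polytope_cell sQ yQ0 GE) hbQ (simple_polytopeE sQ yQ0 GE) GE _ rk).
by move=> v x Qx; exact: (carrier_face_facet sQ yQ0 GE).
Qed.
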